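(* Let $\mathbb P$ be a determinantal point process (DPP) on $(\Lambda,\mu)$ induced by a locally trace class orthogonal projection $\mathrm K$ on $L^2(\Lambda,\mu)$ such that the following holds: for any $\epsilon>0$ and for any bounded $B\in\mathcal B_\Lambda$, there exists a bounded measurable function $f:\Lambda\to[0,+\infty)$ with bounded support such that $$f|_B=1,\qquad \mathrm{Var}\int_\Lambda f\,d\xi<\epsilon,$$ where $\mathrm{Var}$ denotes the variance with respect to $\mathbb P$. Then $\mathbb P$ is marking rigid.
   Context: $\Lambda$ is a complete separable metric space with Borel $\sigma$-algebra $\mathcal B_\Lambda$, and $\mu$ is a positive Borel measure on $\Lambda$ that is finite on bounded Borel sets. $\mathcal N(\Lambda)$ is the set of locally finite Borel counting measures $\xi$ on $\Lambda$, with $\sigma$-algebra $\mathcal C(\Lambda)$ generated by the sets $\{\xi:\xi(B_i)=k_i,\ i=1,\dots,n\}$. A point process is a probability measure on $(\mathcal N(\Lambda),\mathcal C(\Lambda))$; it is simple if a.s. there are no points of multiplicity $>1$. An operator $\mathrm K$ on $L^2(\Lambda,\mu)$ with kernel $K$, $\mathrm Kf(x)=\int_\Lambda K(x,y)f(y)\,d\mu(y)$, is locally trace class if $1_B\mathrm K1_B$ is trace class for every bounded Borel $B$; the diagonal values of $K$ are chosen such that $\mathrm{Tr}\,1_B\mathrm K1_B=\int_BK(x,x)\,d\mu(x)$. The DPP induced by $\mathrm K$ (with kernel $K$) is the simple point process whose correlation functions with respect to $\mu$ are $\rho_m(x_1,\dots,x_m)=\det(K(x_i,x_j))_{i,j=1}^m$.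 Marked process: given measurable $\theta:\Lambda\to[0,1]$, $\mathbb P^\theta$ is the point process on $\Lambda\times\{0,1\}$ obtained by giving each point $x$ of a configuration of $\mathbb P$, independently, mark $1$ with probability $\theta(x)$ and mark $0$ with probability $1-\theta(x)$. $\xi_b$ is the configuration (on $\Lambda$) of points with mark $b$, and $\mathbb P^\theta_b$ is the law of $\xi_b$ under $\mathbb P^\theta$. A (possibly infinite) configuration $\mathbf v=\{v_1,v_2,\dots\}$ is identified with $\delta_{\mathbf v}=\sum_j\delta_{v_j}\in\mathcal N(\Lambda)$. The conditional ensembles $\{\mathbb P^\theta_{|\mathbf v}\}_{\delta_{\mathbf v}\in\mathcal N(\Lambda)}$ are the family of point processes on $\Lambda$ obtained by disintegrating $\mathbb P^\theta$ with respect to the map $\xi_{0,1}\mapsto\xi_1$, i.e. $\mathbb P^\theta_{|\mathbf v}$ is the (regular) conditional law of $\xi_0$ given $\xi_1=\delta_{\mathbf v}$, defined for $\mathbb P^\theta_1$-a.e. $\delta_{\mathbf v}$. Marking rigidity: $\mathbb P$ is marking rigid if for any Borel measurable $\theta:\Lambda\to[0,1]$ there exists a Borel measurable function $\ell:\mathcal N(\Lambda)\to\mathbb N\cup\{0,\infty\}$, $\delta_{\mathbf v}\mapsto\ell_{\mathbf v}$, such that for $\mathbb P^\theta_1$-a.e. $\delta_{\mathbf v}$, $\mathbb P^\theta_{|\mathbf v}(\xi(\Lambda)=\ell_{\mathbf v})=1$. *)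

(* Defs.v *)
From HB Require Import structures.
From mathcomp Require Import all_boot all_order all_algebra.
From mathcomp Require Import complex.
From mathcomp Require Import all_classical all_reals all_analysis measurable_realfun.

Set Implicit Arguments.
Unset Strict Implicit.
Unset Printing Implicit Defensive.

Import Order.TTheory GRing.Theory Num.Theory.
Import numFieldNormedType.Exports.

Local Open Scope classical_set_scope.
Local Open Scope ring_scope.

#[short(type="completeMetricType")]
HB.structure Definition CompleteMetric (K : numDomainType) :=
  {T of Metric K T & CompletePseudoMetric K T}.

Definition separable (T : topologicalType) :=
  exists2 D : set T, countable D & dense D.

Definition metric_bounded (R : realType) (L : metricType R) (A : set L) :=
  exists (x : L) (r : R), forall y, A y -> mdist x y <= r.

Notation borel L := (g_sigma_algebraType (@open L)).

Definition extended_nat (R : realType) (y : \bar R) :=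
  (exists n : nat, y = n%:R%:E) \/ y = +oo%E.

(* Everything below is relative to a measurable space T and a family bnd of
   "bounded" sets; for a metric space these are borel L and metric_bounded. *)

Record config d (T : measurableType d) (R : realType) (bnd : set (set T)) :=
  Config {
    config_measure :> {measure set T -> \bar R};
    config_nat : forall B, measurable B -> extended_nat (config_measure B);
    config_lfin : forall B, measurable B -> bnd B ->
      (config_measure B < +oo)%E }.
Arguments config {d T} R bnd.

Section config_measurable.
Context d (T : measurableType d) (R : realType) (bnd : set (set T)).
Local Notation N := (config R bnd).

HB.instance Definition _ := gen_eqMixin N.
HB.instance Definition _ := gen_choiceMixin N.

Lemma config0_nat (B : set T) :
  measurable B -> extended_nat ((mzero : {measure set T -> \bar R}) B).
Proof. by move=> _; left; exists 0%N. Qed.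

Lemma config0_lfin (B : set T) : measurable B -> bnd B ->
  ((mzero : {measure set T -> \bar R}) B < +oo)%E.
Proof. by move=> _ _; exact: ltry. Qed.

HB.instance Definition _ := isPointed.Build N (Config config0_nat config0_lfin).

Definition config_cylinders : set (set N) :=
  [set C | exists (n : nat) (B : 'I_n -> set T) (k : 'I_n -> nat),
    (forall i, measurable (B i)) /\
    C = [set xi : N | forall i, xi (B i) = (k i)%:R%:E]].

Definition config_display : measure_display.
Proof. by constructor. Qed.

Let config_measurable0 : <<s config_cylinders >> set0.
Proof. exact: sigma_algebra0. Qed.

Let config_measurableC (U : set N) :
  <<s config_cylinders >> U -> <<s config_cylinders >> (~` U).
Proof. exact: sigma_algebraC. Qed.

Let config_measurableU (F : (set N)^nat) :
  (forall i, <<s config_cylinders >> (F i)) ->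
  <<s config_cylinders >> (\bigcup_i F i).
Proof. exact: sigma_algebra_bigcup. Qed.

HB.instance Definition _ := @isMeasurable.Build config_display N
  <<s config_cylinders >> config_measurable0 config_measurableC
  config_measurableU.

End config_measurable.

Section marking.
Context d (T : measurableType d) (R : realType) (bnd : set (set T)).

(* Bounded subsets of T x {0,1}; the mark 1 is true and the mark 0 is false. *)
Definition marked_bnd : set (set (T * bool)) := [set A | bnd (fst @` A)].

Local Notation N := (config R bnd).
Local Notation N01 := (config R marked_bnd).

Definition mark_fun (b : bool) (z : N01) (B : set T) : \bar R :=
  z (B `*` [set b]).

Section mark_measure.
Variables (b : bool) (z : N01).

Let mark_fun0 : mark_fun b z set0 = 0%E.
Proof. by rewrite /mark_fun set0X measure0. Qed.

Let mark_fun_ge0 B : (0 <= mark_fun b z B)%E.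
Proof. exact: measure_ge0. Qed.

Let mark_fun_sigma_additive : semi_sigma_additive (mark_fun b z).
Proof.
move=> F mF tF mUF; rewrite /mark_fun setX_bigcupl.
have mX B : measurable B -> measurable (B `*` [set b]).
  by move=> mB; exact: measurableX.
apply: measure_semi_sigma_additive.
- by move=> i; exact: mX.
- apply/trivIsetP => i j _ _ ij; rewrite -subset0 => -[x c] /= [[Fi _] [Fj _]].
  by move/trivIsetP : tF => /(_ i j I I ij); rewrite -subset0 => /(_ x); exact.
- by rewrite -setX_bigcupl; exact: mX.
Qed.

HB.instance Definition _ := isMeasure.Build _ _ _ (mark_fun b z)
  mark_fun0 mark_fun_ge0 mark_fun_sigma_additive.

Let mark_nat B : measurable B -> extended_nat (mark_fun b z B).
Proof. by move=> mB; apply: config_nat; exact: measurableX. Qed.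

Let mark_lfin B : measurable B -> bnd B -> (mark_fun b z B < +oo)%E.
Proof.
move=> mB bB; apply: config_lfin; first exact: measurableX.
rewrite /marked_bnd/= (_ : _ @` _ = B)//; apply/seteqP; split => [x|x Bx].
  by move=> [[y c]] /= [By _] <-.
by exists (x, b).
Qed.

(* xi_b, the configuration of the points of z with mark b. *)
Definition mark : N := Config mark_nat mark_lfin.

End mark_measure.

Lemma measurable_mark b : measurable_fun [set: N01] (mark b).
Proof.
apply: (@measurability _ _ _ _ _ (mark b) (@config_cylinders _ T R bnd)) => //.
move=> _ [C [n [B [k [mB ->]]]] <-]; rewrite setTI.
apply: sub_sigma_algebra; exists n, (fun i => B i `*` [set b]), k; split => //.
by move=> i; exact: measurableX.
Qed.

HB.instance Definition _ b :=
  isMeasurableFun.Build _ _ _ _ (mark b) (measurable_mark b).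

(* m is the law of the marked configuration obtained from xi by giving its
   points independent marks, equal to 1 with probability theta x at x.  At an
   atom x of multiplicity k, the number of points with mark 1 is binomial with
   parameters k and theta x (Bernoulli when xi is simple); these numbers are
   independent for distinct atoms. *)
Definition independent_marks (theta : T -> R) (xi : N)
    (m : {measure set N01 -> \bar R}) :=
  {ae m, forall z : N01,
    forall B, measurable B -> z (B `*` [set: bool]) = xi B} /\
  forall (n : nat) (x : 'I_n -> T) (k j : 'I_n -> nat),
    injective x -> (forall i, xi [set x i] = (k i)%:R%:E) ->
    m [set z | forall i, z [set (x i, true)] = (j i)%:R%:E] =
      (\prod_(i < n) binomial_pmf (k i) (theta (x i)) (j i))%:E.

(* Q is the point process P^theta on T x {0,1}. *)
Definition marked_process (theta : T -> R) (P : probability N R)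
    (Q : probability N01 R) :=
  exists M : R.-pker N ~> N01,
    {ae P, forall xi, independent_marks theta xi (M xi)} /\
    forall C, measurable C -> Q C = (\int[P]_xi M xi C)%E.

(* kappa is a regular conditional law of xi_0 given xi_1 under Q. *)
Definition conditional_ensembles (Q : probability N01 R)
    (kappa : R.-pker N ~> N) :=
  forall A C : set N, measurable A -> measurable C ->
    Q [set z | A (mark false z) /\ C (mark true z)] =
    (\int[distribution Q (mark true)]_(v in C) kappa v A)%E.

(* For T = borel L with L complete and separable, P^theta exists and is unique,
   and P^theta_{|v} exists and is unique up to a null set of v; "for all Q" and
   "for all kappa" range over these objects and their versions. *)
Definition marking_rigid (P : probability N R) :=
  forall theta : T -> R, measurable_fun [set: T] theta ->
    (forall x, 0 <= theta x <= 1) ->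
  forall Q : probability N01 R, marked_process theta P Q ->
  exists ell : N -> \bar R,
    [/\ measurable_fun [set: N] ell,
        forall v, extended_nat (ell v) &
        forall kappa : R.-pker N ~> N, conditional_ensembles Q kappa ->
          {ae distribution Q (mark true), forall v,
            kappa v [set xi : N | xi [set: T] = ell v] = 1%E}].

End marking.

Section L2.
Context d (T : measurableType d) (R : realType).
Variable mu : {measure set T -> \bar R}.
Local Notation C := R[i].
Implicit Types (f g : T -> C) (A S : (T -> C) -> T -> C).

Definition cmeasurable d' (X : measurableType d') (f : X -> C) :=
  measurable_fun [set: X] (fun x => complex.Re (f x)) /\
  measurable_fun [set: X] (fun x => complex.Im (f x)).

Definition cintegrable (D : set T) f :=
  mu.-integrable D (fun x => (complex.Re (f x))%:E) /\
  mu.-integrable D (fun x => (complex.Im (f x))%:E).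

Definition cintegral (D : set T) f : C :=
  Complex (\int[mu]_(x in D) complex.Re (f x))
          (\int[mu]_(x in D) complex.Im (f x)).

Definition L2 f := cmeasurable f /\
  (\int[mu]_x (complex.Re (f x) ^+ 2 + complex.Im (f x) ^+ 2)%:E < +oo)%E.

Definition L2dot f g : C := cintegral [set: T] (fun x => f x * conjc (g x)).

(* Elements of L^2(T, mu) are represented by functions, and operators by maps
   on functions that are compatible with equality mu-a.e. *)
Definition L2_operator A :=
  [/\ forall f, L2 f -> L2 (A f),
      forall f g, L2 f -> L2 g -> {ae mu, forall x, f x = g x} ->
        {ae mu, forall x, A f x = A g x},
      forall (a : C) f g, L2 f -> L2 g ->
        {ae mu, forall x, A (fun y => a * f y + g y) x = a * A f x + A g x} &
      exists M : R, forall f, L2 f ->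
        complex.Re (L2dot (A f) (A f)) <= M * complex.Re (L2dot f f)].

Definition orthogonal_projection A :=
  [/\ L2_operator A,
      forall f, L2 f -> {ae mu, forall x, A (A f) x = A f x} &
      forall f g, L2 f -> L2 g -> L2dot (A f) g = L2dot f (A g)].

Definition has_kernel A (K : T -> T -> C) :=
  cmeasurable (fun p : T * T => K p.1 p.2) /\
  forall f, L2 f -> {ae mu, forall x,
    cintegrable [set: T] (fun y => K x y * f y) /\
    A f x = cintegral [set: T] (fun y => K x y * f y)}.

(* Indexed by a subset I of nat, since L^2 may be finite-dimensional. *)
Definition orthonormal_basis (I : pred nat) (e : nat -> T -> C) :=
  [/\ forall i, I i -> L2 (e i),
      forall i j, I i -> I j -> L2dot (e i) (e j) = (i == j)%:R &
      forall f, L2 f -> (forall i, I i -> L2dot f (e i) = 0) ->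
        {ae mu, forall x, f x = 0}].

(* S = |A|, i.e. S >= 0 and S^2 = A^* A. *)
Definition operator_abs A S :=
  [/\ L2_operator S, forall f, L2 f -> 0 <= L2dot (S f) f &
      forall f g, L2 f -> L2 g -> L2dot (S f) (S g) = L2dot (A f) (A g)].

Definition trace_class A := L2_operator A /\
  exists S I e, [/\ operator_abs A S, orthonormal_basis I e &
    (\sum_(0 <= i <oo | I i) (complex.Re (L2dot (S (e i)) (e i)))%:E < +oo)%E].

Definition has_trace A (t : C) :=
  forall I e, orthonormal_basis I e ->
    let s n := \sum_(0 <= i < n | I i) L2dot (A (e i)) (e i) in
    (complex.Re (s n) @[n --> \oo] --> complex.Re t) /\
    (complex.Im (s n) @[n --> \oo] --> complex.Im t).

(* 1_B A 1_B *)
Definition compress (B : set T) A f : T -> C :=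
  fun x => (\1_B x : C) * A (fun y => (\1_B y : C) * f y) x.

Definition locally_trace_class (bnd : set (set T)) A :=
  forall B, measurable B -> bnd B -> trace_class (compress B A).

Definition trace_diagonal (bnd : set (set T)) A (K : T -> T -> C) :=
  forall B, measurable B -> bnd B -> cintegrable B (fun x => K x x) /\
    has_trace (compress B A) (cintegral B (fun x => K x x)).

End L2.

Section dpp.
Context d (T : measurableType d) (R : realType) (bnd : set (set T)).
Variable mu : {measure set T -> \bar R}.
Local Notation N := (config R bnd).

Definition simple (P : probability N R) :=
  {ae P, forall xi : N, forall x, (xi [set x] <= 1)%E}.

(* Integral of rho over B_1 x ... x B_m with respect to the m-fold product of
   mu, written as an iterated integral. *)
Fixpoint iter_integral (m : nat) :
    m.-tuple (set T) -> (m.-tuple T -> \bar R) -> \bar R :=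
  match m with
  | 0 => fun _ rho => rho [tuple]
  | m'.+1 => fun B rho =>
      (\int[mu]_(x in thead B)
         iter_integral (behead_tuple B) (fun xs => rho (cons_tuple x xs)))%E
  end.

(* For a simple point process, rho_m is a correlation function if
   E[xi(B_1) ... xi(B_m)] is its integral over B_1 x ... x B_m for disjoint
   bounded B_1, ..., B_m, and if it vanishes when two coordinates coincide (as
   determinants of kernels do). *)
Definition correlation_function (P : probability N R) (m : nat)
    (rho : m.-tuple T -> R) :=
  (forall x : m.-tuple T, ~~ uniq x -> rho x = 0) /\
  forall B : m.-tuple (set T),
    (forall i, measurable (tnth B i)) -> (forall i, bnd (tnth B i)) ->
    trivIset [set: 'I_m] (tnth B) ->
    (\int[P]_xi \prod_(i < m) xi (tnth B i))%E =
    iter_integral B (fun x => (rho x)%:E).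

(* The determinant is real mu-a.e., K being Hermitian; Re only changes the
   type. *)
Definition det_kernel (K : T -> T -> R[i]) (m : nat) (x : m.-tuple T) : R :=
  complex.Re (\det (\matrix_(i < m, j < m) K (tnth x i) (tnth x j))).

Definition is_dpp (P : probability N R) (K : T -> T -> R[i]) :=
  simple P /\ forall m, correlation_function P (@det_kernel K m).

End dpp.

(* Main.v *)
Require Import Defs.
From HB Require Import structures.
From mathcomp Require Import all_boot all_order all_algebra.
From mathcomp Require Import complex.
From mathcomp Require Import all_classical all_reals all_analysis measurable_realfun.
From mathcomp Require Import ring lra.

Set Implicit Arguments.
Unset Strict Implicit.
Unset Printing Implicit Defensive.

Import Order.TTheory GRing.Theory Num.Theory.
Import numFieldNormedType.Exports.

Local Open Scope classical_set_scope.
Local Open Scope ring_scope.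

(** Write [xi = xi_0 + xi_1] for the splitting of the configuration by its
marks, and let [E_k] be bounded sets increasing to the whole space.  Suppose
that [f_k] takes its values in [0, 1], equals 1 on [E_k], has bounded support,
and that the variances of the linear statistics [\int f_k dxi] are summable.
With [c_k] the mean of [\int f_k dxi], almost surely
  [\int f_k dxi_0 + \int f_k dxi_1 - c_k --> 0].
Since [xi_0 E_k <= \int f_k dxi_0 <= xi_0 T], the first term tends to the total
number of points of [xi_0], finite or infinite, and that number is therefore
the limit of [c_k - \int f_k dxi_1], a function of [xi_1] alone
([total_estimatorE], [marking_rigid_of_vanishing_variance]).

The hypothesis on variances provides functions that equal 1 on a given bounded
set but are only known to be bounded, while the squeeze needs the upper bound 1.
So [f] is replaced by [g = min f 1], and the point is that this does not
increase the variance ([variance_truncate]).  Linear statistics with disjoint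
supports are negatively correlated ([cov_le0]).  Consequently, if [h >= 0] is
supported in a bounded set [S], then [cov h \1_S >= 0]: for [F] equal to 1 on
[S] and of small variance, [cov h F] is nearly 0, and [F - \1_S] is supported
off [S] ([cov_indic_ge0]).  Now take [h = f - g].  It lives where [g = 1], so
[\1_S - g] has a support disjoint from that of [h] when [S] is the support of
[f], and [cov g h >= cov \1_S h >= 0]; hence
  [Var f = Var g + 2 cov g h + Var h >= Var g].

Negative correlation comes from the determinant
  [rho_2 x y = K x x * K y y - K x y * K y x],
which is at most [K x x * K y y] as soon as [K y x] is the conjugate of [K x y]
and [K x x] is real.  Both hold almost everywhere, as the operator is
self-adjoint ([kernel_hermitian], [Im_diagonal_eq0]); indicators of disjoint
bounded sets are thus negatively correlated ([integral_det_kernel_le]), and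
this extends to functions by peeling off half of the height repeatedly
([cov_le0_of_indic]). *)

(** * Configurations and linear statistics *)
Section statistics.
Context d (T : measurableType d) (R : realType) (bnd : set (set T)).
Local Notation N := (config R bnd).

Lemma measurable_set_extended_nat (Y : set (\bar R)) :
  Y `<=` @extended_nat R -> measurable Y.
Proof.
move=> Yn; rewrite (_ : Y = (\bigcup_n (Y `&` [set n%:R%:E])) `|` (Y `&` [set +oo%E])).
  have mI (y : \bar R) : measurable (Y `&` [set y]).
    have [Yy|nYy] := pselect (Y y).
      by rewrite (_ : _ `&` _ = [set y])//; apply/seteqP; split => [x []|x ->].
    by rewrite (_ : _ `&` _ = set0)//; apply/seteqP; split => // x [/[swap] ->].
  by apply: measurableU => //; apply: bigcupT_measurable => n; exact: mI.
apply/seteqP; split => [y Yy|y [[n _ []]//|[]//]].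
by have [[n yn]|yoo] := Yn y Yy; [left; exists n|right].
Qed.

(** Only the events where [xi B] takes a given finite value are in the
generating family; since the values are in [{0, 1, ..., +oo}], the event
[xi B = +oo] is the complement of their countable union. *)
Lemma measurable_config_eval (B : set T) : measurable B ->
  measurable_fun [set: N] (fun xi : N => xi B).
Proof.
move=> mB.
have mC (n : nat) : measurable [set xi : N | xi B = n%:R%:E].
  apply: sub_sigma_algebra; exists 1%N, (fun=> B), (fun=> n); split => //.
  apply/seteqP; split => xi /=; first by move=> ->.
  by move/(_ ord0).
have mF (y : \bar R) : measurable [set xi : N | xi B = y].
  have [[n ->]//|yoo] : (exists n : nat, y = n%:R%:E) \/ ~ (exists n : nat, y = n%:R%:E).
    exact: EM.
  have [y_oo|ny] := eqVneq y +oo%E.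
    rewrite (_ : [set _ | _] = ~` \bigcup_n [set xi : N | xi B = n%:R%:E]).
      by apply: measurableC; exact: bigcupT_measurable.
    apply/seteqP; split => xi /=.
      by rewrite y_oo => xioo [n _] /=; rewrite xioo.
    rewrite y_oo => h; have [[n xin]|//] := config_nat xi mB.
    by exfalso; apply: h; exists n.
  rewrite (_ : [set _ | _] = set0)//; apply/seteqP; split => // xi /= xy.
  have [[n xin]|] := config_nat xi mB.
    by apply: yoo; exists n; rewrite -xy.
  by rewrite xy => /eqP; rewrite (negbTE ny).
move=> _ Y mY; rewrite setTI.
rewrite (_ : _ @^-1` _ = (\bigcup_n (if `[< Y n%:R%:E >] then
   [set xi : N | xi B = n%:R%:E] else set0)) `|`
   (if `[< Y +oo%E >] then [set xi : N | xi B = +oo%E] else set0)).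
  apply: measurableU; last by case: ifP.
  by apply: bigcupT_measurable => n; case: ifP.
apply/seteqP; split => [xi /= Yxi|xi /= [[n _]|]].
- have [[n xin]|xioo] := config_nat xi mB.
    by left; exists n => //; rewrite asboolT// -xin.
  by right; rewrite asboolT// -xioo.
- by case: asboolP => //= Yn ->.
- by case: asboolP => //= Yn ->.
Qed.

Lemma measurable_config_integral (f : T -> \bar R) : (forall x, 0 <= f x)%E ->
  measurable_fun [set: T] f ->
  measurable_fun [set: N] (fun xi : N => \int[xi]_x f x)%E.
Proof.
move=> f0 mf.
exact: (measurable_fun_integral_kernel measurable_config_eval f0 mf).
Qed.

Definition test_function (f : T -> R) :=
  [/\ measurable_fun [set: T] f, exists M : R, forall x, 0 <= f x <= M &
      bnd [set x | f x != 0]].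

Definition linear_statistic (f : T -> R) (xi : N) : R := \int[xi]_x f x.

Lemma measurable_support (f : T -> R) : measurable_fun [set: T] f ->
  measurable [set x | f x != 0].
Proof.
move=> mf; rewrite (_ : [set _ | _] = f @^-1` (~` [set 0])).
  by rewrite -[X in measurable X]setTI; apply: mf => //; exact: measurableC.
by apply/seteqP; split => x /= /eqP.
Qed.

Lemma test_ge0 f x : test_function f -> 0 <= f x.
Proof. by case=> _ [M /(_ x)/andP[]]. Qed.

(** Stated for a function and a set that contains its support, so as to give
both finiteness for test functions and, with bound 1, comparison with the total
mass. *)
Lemma test_integral_le (f : T -> R) (M : R) (S : set T) (m : {measure set T -> \bar R}) :
  measurable_fun [set: T] f -> measurable S -> (forall x, 0 <= f x <= M) ->
  (forall x, f x != 0 -> S x) ->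
  (\int[m]_x (f x)%:E <= M%:E * m S)%E.
Proof.
move=> mf mS fM fS.
rewrite -(@integral_cst _ _ _ m S mS M%:E) (integral_mkcond S).
apply: ge0_le_integral => //.
- by move=> x _; rewrite lee_fin; have /andP[] := fM x.
- exact/measurable_EFinP.
- by apply/(measurable_restrictT _ _).1 => //; exact: measurable_cst.
- move=> x _; rewrite patchE; case: ifPn => xS.
    by rewrite /cst lee_fin; have /andP[] := fM x.
  rewrite lee_fin; have [->//|fx] := eqVneq (f x) 0.
  by move: xS; rewrite notin_setE => /(_ (fS _ fx)).
Qed.

Lemma test_integral_fin_num (f : T -> R) (xi : N) : test_function f ->
  (\int[xi]_x (f x)%:E)%E \is a fin_num.
Proof.
move=> [mf [M fM] bf]; rewrite ge0_fin_numE; last first.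
  by apply: integral_ge0 => x _; rewrite lee_fin; have /andP[] := fM x.
apply: (le_lt_trans (test_integral_le _ mf (measurable_support mf) fM _)) => //.
have M0 : 0 <= M by have /andP[/le_trans h /h] := fM point.
apply: lte_mul_pinfty => //.
by apply: config_lfin => //; exact: measurable_support.
Qed.

Lemma linear_statisticE (f : T -> R) (xi : N) : test_function f ->
  (linear_statistic f xi)%:E = (\int[xi]_x (f x)%:E)%E.
Proof. by move=> tf; rewrite fineK// test_integral_fin_num. Qed.

Lemma linear_statistic_ge0 (f : T -> R) (xi : N) : test_function f ->
  0 <= linear_statistic f xi.
Proof. by move=> tf; apply: Rintegral_ge0 => x _; exact: test_ge0. Qed.

Lemma measurable_linear_statistic (f : T -> R) : test_function f ->
  measurable_fun [set: N] (linear_statistic f).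
Proof.
move=> tf; have [mf _ _] := tf; apply: (measurableT_comp (fine_measurable measurableT)).
apply: measurable_config_integral => [x|]; last exact/measurable_EFinP.
by rewrite lee_fin test_ge0.
Qed.

(** * Rigidity from linear statistics of small variance *)

Variables (P : probability N R) (E : nat -> set T) (f : nat -> T -> R).
Hypotheses (mE : forall k, measurable (E k)) (ndE : nondecreasing_seq E)
  (UE : \bigcup_k E k = [set: T]).
Hypotheses (mf : forall k, measurable_fun [set: T] (f k))
  (f01 : forall k x, 0 <= f k x <= 1) (bf : forall k, bnd [set x | f k x != 0])
  (fE : forall k x, E k x -> f k x = 1)
  (Vf : forall k, ('V_P[linear_statistic (f k)] < (1 / (2 ^ k.+1)%:R)%:E)%E).

Let c k : R := fine 'E_P[linear_statistic (f k)].

Let tf k : test_function (f k).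
Proof. by split => //; exists 1 => x; exact: f01. Qed.

Let g k (xi : N) : \bar R := ((linear_statistic (f k) xi - c k) ^+ 2)%:E.

Let g0 k xi : (0 <= g k xi)%E.
Proof. by rewrite lee_fin sqr_ge0. Qed.

Let mg k : measurable_fun [set: N] (g k).
Proof.
apply/measurable_EFinP; apply: measurable_funX.
by apply: measurable_funB => //; exact: measurable_linear_statistic.
Qed.

(** The sum over [k] of the squared deviations has a finite mean, so it is
almost surely finite and its terms tend to 0. *)
Lemma linear_statistic_ae_cvg :
  {ae P, forall xi : N, linear_statistic (f k) xi - c k @[k --> \oo] --> 0}.
Proof.
have intg : (\int[P]_xi \sum_(k <oo) g k xi < +oo)%E.
  rewrite integral_nneseries//.
  apply: (@le_lt_trans _ _ (\sum_(k <oo) (1 / (2 ^ k.+1)%:R)%:E)%E).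
    apply: lee_nneseries => k _; first by move=> _; apply: integral_ge0 => xi _; exact: g0.
    apply: ltW; have := Vf k; rewrite /variance unlock unlock.
    move=> Vk; apply: le_lt_trans Vk; rewrite le_eqVlt; apply/orP; left.
    by apply/eqP; apply: eq_integral => xi _; rewrite /g expr2 /c unlock.
  by apply: le_lt_trans (epsilon_trick0 xpredT (@ler01 R)) _; exact: ltry.
have mS : measurable_fun [set: N] (fun xi => \sum_(k <oo) g k xi)%E.
  by apply: ge0_emeasurable_sum => // k xi _ _; exact: g0.
have : P.-integrable [set: N] (fun xi => \sum_(k <oo) g k xi)%E.
  apply/integrableP; split => //.
  under eq_integral do rewrite gee0_abs ?nneseries_ge0//.
  exact: intg.
move/(integrable_ae measurableT); apply: filterS => xi /(_ I) xifin.
pose u k := (linear_statistic (f k) xi - c k) ^+ 2.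
have /cvg_series_cvg_0/cvgrPdist_lt u0 : cvgn (series u).
  apply: nondecreasing_is_cvgn.
    by apply/nondecreasing_seqP => n; rewrite !seriesEnat/= big_nat_recr//= lerDl sqr_ge0.
  exists (fine (\sum_(k <oo) g k xi)%E) => _ [n _ <-].
  rewrite -lee_fin fineK// seriesEnat/= -sumEFin.
  by apply: (@nneseries_lim_ge R (fun k => g k xi) xpredT 0 n) => k _ _; exact: g0.
apply/cvgrPdist_lt => e e0; have := u0 (e ^+ 2); rewrite exprn_gt0// => /(_ isT).
apply: filterS => k; rewrite !sub0r !normrN normrX ltr_pXn2r// ?nnegrE//.
exact: ltW.
Qed.

Lemma linear_statistic_add (z0 z1 xi : N) k :
  (forall B, measurable B -> (z0 B + z1 B = xi B)%E) ->
  linear_statistic (f k) z0 + linear_statistic (f k) z1 = linear_statistic (f k) xi.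
Proof.
move=> zxi; apply: EFin_inj; rewrite EFinD !linear_statisticE//.
rewrite -ge0_integral_measure_add//.
- apply: eq_measure_integral => B mB _.
  by rewrite /= /msum !big_ord_recl big_ord0 adde0 zxi.
- by move=> x _; rewrite lee_fin test_ge0.
- exact/measurable_EFinP.
Qed.

(** The integral of [f k] lies between [z (E k)] and [z [set: T]]; this covers
infinite configurations as well. *)
Lemma linear_statistic_cvg_total (z : N) :
  (linear_statistic (f k) z)%:E @[k --> \oo] --> z [set: T].
Proof.
apply: (@squeeze_cvge _ _ _ _ (fun k => z (E k)) _ (fun=> z [set: T])).
- apply: nearW => k; rewrite linear_statisticE//; apply/andP; split.
    rewrite -[leLHS]mul1e -(@integral_cst _ _ _ z (E k) (mE k) 1%E) integral_mkcond.
    apply: ge0_le_integral => //.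
    + by move=> x _; rewrite patchE; case: ifP.
    + by apply/(measurable_restrictT _ _).1 => //; exact: measurable_cst.
    + exact/measurable_EFinP.
    + move=> x _; rewrite patchE; case: ifPn => xE; last by rewrite lee_fin test_ge0.
      by rewrite /= fE//; exact: set_mem.
  by rewrite -[leRHS]mul1e; exact: test_integral_le.
- by rewrite -UE; apply: nondecreasing_cvg_mu => //; rewrite UE.
- exact: cvg_cst.
Qed.

(** The upper limit makes this a measurable function of every [v]; on the
relevant configurations it is a limit. *)
Definition total_estimator (v : N) : \bar R :=
  limn_esup (fun k => (c k - linear_statistic (f k) v)%:E).

Lemma measurable_total_estimator : measurable_fun [set: N] total_estimator.
Proof.
apply: measurable_fun_limn_esup => k; apply/measurable_EFinP.
by apply: measurable_funB => //; exact: measurable_linear_statistic.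
Qed.

Lemma total_estimatorE (z0 z1 xi : N) :
  linear_statistic (f k) xi - c k @[k --> \oo] --> 0 ->
  (forall B, measurable B -> (z0 B + z1 B = xi B)%E) ->
  total_estimator z1 = z0 [set: T].
Proof.
move=> xi0 zxi; apply: (cvg_limn_einf_sup _).2.
rewrite [X in X @ _ --> _](_ : _ = (fun k => (linear_statistic (f k) z0)%:E -
    (linear_statistic (f k) xi - c k)%:E)%E); last first.
  apply/funext => k; rewrite -(linear_statistic_add k zxi) -EFinB; congr EFin.
  by ring.
rewrite -[X in _ --> X]sube0; apply: cvgeB => //.
- by rewrite fin_num_adde_defl.
- exact: linear_statistic_cvg_total.
- by apply: cvg_EFin => //; exact: nearW.
Qed.

Lemma mark_add (z : config R (marked_bnd bnd)) B : measurable B ->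
  z (B `*` [set: bool]) = (mark false z B + mark true z B)%E.
Proof.
move=> mB; rewrite /= /mark_fun -measureU.
- congr (z _); apply/seteqP; split => [[x []] [Bx _]|[x b] [] []//].
    by right.
  by left.
- exact: measurableX.
- exact: measurableX.
- by rewrite -setXI (_ : _ `&` [set true] = set0) ?setX0// -subset0 => -[] [].
Qed.

(** Almost surely the number of points with mark 0 is [total_estimator] of the
points with mark 1.  This identity is transferred to a regular conditional law
one value at a time: for a fixed [y], the event that the estimator equals [y]
and the number does not is null, so the conditional law charges only the value
[y] there; there are countably many values. *)
Lemma marking_rigid_of_vanishing_variance : marking_rigid P.
Proof.
move=> theta _ _ Q [M [PM QE]].
pose Z := config R (marked_bnd bnd).
pose G := [set z : Z | total_estimator (mark true z) = mark false z [set: T]].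
have mtot b : measurable_fun [set: Z] (fun z : Z => mark b z [set: T]).
  apply: (@measurableT_comp _ _ _ _ _ _ (fun xi : N => xi [set: T])).
    exact: measurable_config_eval.
  exact: measurable_mark.
have mest : measurable_fun [set: Z] (fun z : Z => total_estimator (mark true z)).
  apply: (@measurableT_comp _ _ _ _ _ _ total_estimator).
    exact: measurable_total_estimator.
  exact: measurable_mark.
have mG : measurable G.
  by rewrite -[G]setTI; exact: measurable_eqe.
have QG : Q (~` G) = 0%E.
  rewrite QE; last exact: measurableC.
  rewrite (ae_eq_integral (cst 0%E)) ?integral0//.
    exact: measurable_kernel (measurableC mG).
  apply: filterS2 linear_statistic_ae_cvg PM => xi xi0 [xiM _] _.
  apply/negligibleP; first exact: measurableC.
  apply: negligibleS xiM => z /= nG h; apply: nG.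
  by apply: (total_estimatorE xi0) => B mB; rewrite -mark_add// h.
pose D : set N := total_estimator @^-1` (@extended_nat R).
have mD : measurable D.
  rewrite -[D]setTI; apply: measurable_total_estimator => //.
  exact: measurable_set_extended_nat.
(* Off D the restriction is 0, which is an extended natural number. *)
pose ell : N -> \bar R := total_estimator \_ D.
have mell : measurable_fun [set: N] ell.
  have [+ _] := measurable_restrictT total_estimator mD.
  by apply; exact: measurable_funTS measurable_total_estimator.
have ellE v : extended_nat (ell v).
  by rewrite /ell patchE; case: ifPn => [/set_mem//|_]; left; exists 0%N.
exists ell; split => // kappa kQ.
pose C y := [set v : N | ell v = y].
pose B y := [set xi : N | xi [set: T] = y].
have mC y : measurable (C y).
  rewrite (_ : C y = [set: N] `&` ell @^-1` [set y]); first exact: mell.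
  by rewrite setTI.
have mB y : measurable (B y).
  rewrite (_ : B y = [set: N] `&` (fun xi : N => xi [set: T]) @^-1` [set y]).
    exact: measurable_config_eval.
  by rewrite setTI.
have CB y : {ae distribution Q (mark true),
    forall v, C y v -> kappa v (~` B y) = 0%E}.
  have mk : measurable_fun [set: N] (kappa ^~ (~` B y)).
    by apply: measurable_kernel; exact: measurableC.
  have := kQ _ _ (measurableC (mB y)) (mC y).
  rewrite (@subset_measure0 _ _ _ _ _ (~` G) _ _ _ QG)//; last 3 first.
  - have mA : measurable [set z : Z | (~` B y) (mark false z)].
      rewrite -[X in measurable X]setTI.
      by apply: (measurable_mark _ measurableT); exact: measurableC.
    have mC' : measurable [set z : Z | C y (mark true z)].
      by rewrite -[X in measurable X]setTI; exact: (measurable_mark _ measurableT).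
    exact: measurableI mA mC'.
  - exact: measurableC.
  - move=> z /= [nB Cz] Gz; apply: nB; rewrite /B /= -Cz /ell patchE Gz mem_set//.
    by rewrite /D /= Gz; exact: config_nat.
  move/esym => k0.
  have [] := @ae_eq_integral_abs _ _ _ (distribution Q (mark true)) (C y) (mC y)
    (kappa ^~ (~` B y)).
    exact: measurable_funTS.
  move=> + _; apply.
  by rewrite -[RHS]k0; apply: eq_integral => v _; rewrite gee0_abs.
have {}CB y : {ae distribution Q (mark true),
    forall v, C y v -> kappa v (B y) = 1%E}.
  apply: filterS (CB y) => v /[apply] k0.
  have : kappa v (B y `|` ~` B y) = 1%E by rewrite setUv prob_kernel.
  have mBC : measurable (~` B y) by exact: measurableC.
  by move=> <-; rewrite measureU ?setICr//; rewrite [X in (_ = _ + X)%E]k0 adde0.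
apply: filterS2 (ae_foralln (fun n : nat => CB n%:R%:E)) (CB +oo%E) => v kn koo.
by have [[n vn]|voo] := ellE v; [rewrite vn; exact: kn|rewrite voo; exact: koo].
Qed.

End statistics.

(** * Square integrable variables *)
Section square_integrable.
Context d (T : measurableType d) (R : realType) (P : probability T R).

Lemma Lfun2_of_sqr (X : T -> R) : measurable_fun [set: T] X ->
  (\int[P]_x (X x ^+ 2)%:E < +oo)%E -> X \in Lfun P 2%:E.
Proof.
move=> mX Xoo; rewrite inE/=; apply/andP; split; rewrite inE//=.
rewrite /finite_norm unlock /Lnorm poweR_lty//.
under eq_integral => x _ do rewrite /= powR_mulrn// real_normK ?num_real//.
exact: Xoo.
Qed.

Lemma le_Lfun2 (X Y : T -> R) : measurable_fun [set: T] X ->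
  (forall x, 0 <= X x <= Y x) -> Y \in Lfun P 2%:E -> X \in Lfun P 2%:E.
Proof.
move=> mX XY Y2; apply: Lfun2_of_sqr => //.
have /integrableP[mY2] := Lfun2_integrable_sqr Y2.
apply: le_lt_trans; apply: ge0_le_integral => //.
- by move=> x _; rewrite lee_fin sqr_ge0.
- by apply/measurable_EFinP; exact: measurable_funX.
- exact: measurableT_comp.
- move=> x _ /=; rewrite lee_fin ger0_norm ?sqr_ge0//.
  have /andP[X0 XYx] := XY x.
  by rewrite lerXn2r// nnegrE// (le_trans X0).
Qed.

(** The variance is the second moment of [X - c] for a constant [c], whether or
not [X] is integrable, so its finiteness suffices. *)
Lemma Lfun2_of_variance (X : T -> R) : measurable_fun [set: T] X ->
  ('V_P[X] < +oo)%E -> X \in Lfun P 2%:E.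
Proof.
move=> mX; rewrite /variance unlock; set c := fine _ => VX.
rewrite (_ : X = (X \- cst c) \+ cst c); last by apply/funext => x /=; rewrite subrK.
apply: rpredD => [|Hyp0|Hyp0]; [by rewrite lee1n| |exact: Lfun_cst].
apply: Lfun2_of_sqr; first exact: measurable_funB.
move: VX; rewrite unlock; apply: le_lt_trans; rewrite le_eqVlt; apply/orP; left.
by apply/eqP; apply: eq_integral => x _; rewrite expr2.
Qed.

End square_integrable.

(** * Covariances of linear statistics *)
Section covariance.
Context d (T : measurableType d) (R : realType) (bnd : set (set T)).
Hypothesis bnd_sub : forall A B : set T, A `<=` B -> bnd B -> bnd A.
Hypothesis bndU : forall A B : set T, bnd A -> bnd B -> bnd (A `|` B).
Local Notation N := (config R bnd).
Local Notation test := (@test_function _ T R bnd).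

Lemma testD (f g : T -> R) : test f -> test g -> test (f \+ g).
Proof.
move=> [mf [M fM] bf] [mg [M' gM] bg]; split.
- exact: measurable_funD.
- exists (M + M') => x; have /andP[? ?] := fM x; have /andP[? ?] := gM x.
  by rewrite /= addr_ge0// lerD.
- apply: bnd_sub (bndU bf bg) => x /= fg0.
  have [fx|] := eqVneq (f x) 0; last by left.
  by right; apply: contra_neq fg0 => gx; rewrite fx gx addr0.
Qed.

Lemma testZ (a : R) (f : T -> R) : 0 <= a -> test f -> test (a \o* f).
Proof.
move=> a0 [mf [M fM] bf]; split.
- exact: measurable_funM.
- exists (M * a) => x; have /andP[? ?] := fM x.
  by rewrite /= mulr_ge0// ler_wpM2r.
- by apply: bnd_sub bf => x /=; apply: contra_neq => ->; rewrite mul0r.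
Qed.

Lemma test_le (f g : T -> R) : measurable_fun [set: T] f ->
  (forall x, 0 <= f x <= g x) -> test g -> test f.
Proof.
move=> mf fg [mg [M gM] bg]; split => //.
- exists M => x; have /andP[-> /le_trans->//] := fg x.
  by have /andP[] := gM x.
- apply: bnd_sub bg => x /=; apply: contra_neq => gx.
  by have := fg x; rewrite gx => ?; apply/le_anti; rewrite andbC.
Qed.

Lemma test_indic (A : set T) : measurable A -> bnd A -> test (\1_A).
Proof.
move=> mA bA; split.
- exact: measurable_indic.
- by exists 1 => x; rewrite indicE; case: (_ \in _) => //=; rewrite lexx ler01.
- apply: bnd_sub bA => x /=; rewrite indicE; case: (boolP (x \in A)) => [/set_mem//|_].
  by rewrite eqxx.
Qed.

Lemma linear_statisticD (f g : T -> R) : test f -> test g ->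
  linear_statistic (f \+ g) = (linear_statistic f : N -> R) \+ linear_statistic g.
Proof.
move=> tf tg; apply/funext => xi /=; apply: EFin_inj.
rewrite EFinD !linear_statisticE//; last exact: testD.
have [mf _ _] := tf; have [mg _ _] := tg.
rewrite -ge0_integralD//.
- by move=> x _; rewrite lee_fin (test_ge0 _ tf).
- exact/measurable_EFinP.
- by move=> x _; rewrite lee_fin (test_ge0 _ tg).
- exact/measurable_EFinP.
Qed.

Lemma linear_statisticZ (a : R) (f : T -> R) : 0 <= a -> test f ->
  linear_statistic (a \o* f) = a \o* (linear_statistic f : N -> R).
Proof.
move=> a0 tf; apply/funext => xi /=; apply: EFin_inj.
rewrite mulrC EFinM !linear_statisticE//; last exact: testZ.
have [mf _ _] := tf.
rewrite -ge0_integralZl//.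
- by apply: eq_integral => x _; rewrite /= mulrC.
- exact/measurable_EFinP.
- by move=> x _; rewrite lee_fin (test_ge0 _ tf).
Qed.

Lemma linear_statistic_indic (A : set T) (xi : N) : measurable A -> bnd A ->
  (linear_statistic (\1_A) xi)%:E = xi A.
Proof.
by move=> mA bA; rewrite linear_statisticE; [rewrite integral_indic// setIT|exact: test_indic].
Qed.

Lemma le_linear_statistic (f g : T -> R) (xi : N) : test f -> test g ->
  (forall x, f x <= g x) -> linear_statistic f xi <= linear_statistic g xi.
Proof.
move=> tf tg fg; rewrite -lee_fin !linear_statisticE//.
have [mf _ _] := tf; have [mg _ _] := tg.
apply: ge0_le_integral => //.
- by move=> x _; rewrite lee_fin (test_ge0 _ tf).
- exact/measurable_EFinP.
- exact/measurable_EFinP.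
- by move=> x _; rewrite lee_fin.
Qed.

Variable P : probability N R.
Hypothesis negative_association : forall B C : set T,
  measurable B -> measurable C -> bnd B -> bnd C -> B `&` C = set0 ->
  (\int[P]_xi (xi B * xi C) <= (\int[P]_xi xi B) * (\int[P]_xi xi C))%E.
Hypothesis small_variance : forall (eps : R) (B : set T), 0 < eps ->
  measurable B -> bnd B ->
  exists f : T -> R, [/\ test f, forall x, B x -> f x = 1 &
    ('V_P[linear_statistic f] < eps%:E)%E].

(** The hypothesis on variances, applied to the support of [f], provides a
square integrable statistic that dominates a multiple of that of [f]. *)
Lemma test_Lfun2 f : test f -> linear_statistic f \in Lfun P 2%:E.
Proof.
move=> tf; have [mf [M fM] bf] := tf.
have [F [tF FE VF]] := small_variance ltr01 (measurable_support mf) bf.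
have F2 : linear_statistic F \in Lfun P 2%:E.
  by apply: Lfun2_of_variance; [exact: measurable_linear_statistic|exact: lt_trans VF (ltry _)].
have M0 : 0 <= M by have /andP[/le_trans h /h] := fM point.
have MF2 := Lfun_scale M (ler1n R 2) F2.
apply: le_Lfun2 MF2; first exact: measurable_linear_statistic.
move=> xi; rewrite linear_statistic_ge0//=.
have /(congr1 (@^~ xi)) /= <- := linear_statisticZ M0 tF.
apply: le_linear_statistic => //; first exact: testZ.
move=> x /=; have [->|fx] := eqVneq (f x) 0.
  by rewrite mulr_ge0// (test_ge0 _ tF).
by rewrite FE// mul1r; have /andP[] := fM x.
Qed.

Definition cov (f g : T -> R) : R :=
  fine (covariance P (linear_statistic f) (linear_statistic g)).

Lemma covC f g : cov f g = cov g f.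
Proof. by rewrite /cov covarianceC. Qed.

Let Lfun1 f : test f -> linear_statistic f \in Lfun P 1.
Proof. by move=> tf; apply: Lfun_subset12 (test_Lfun2 tf); exact: fin_num_measure. Qed.

Let LfunM f g : test f -> test g ->
  (linear_statistic f * linear_statistic g)%R \in Lfun P 1.
Proof. by move=> tf tg; apply: Lfun2_mul_Lfun1; exact: test_Lfun2. Qed.

Lemma EFin_cov f g : test f -> test g ->
  (cov f g)%:E = covariance P (linear_statistic f) (linear_statistic g).
Proof.
move=> tf tg; rewrite fineK//.
by rewrite covariance_fin_num//; [exact: Lfun1|exact: Lfun1|exact: LfunM].
Qed.

Lemma covDl f g h : test f -> test g -> test h -> cov (f \+ g) h = cov f h + cov g h.
Proof.
move=> tf tg th; apply: EFin_inj; rewrite EFinD !EFin_cov//; last exact: testD.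
by rewrite linear_statisticD// covarianceDl//; exact: test_Lfun2.
Qed.

Lemma covZl a f g : 0 <= a -> test f -> test g -> cov (a \o* f) g = a * cov f g.
Proof.
move=> a0 tf tg; apply: EFin_inj; rewrite EFinM !EFin_cov//; last exact: testZ.
by rewrite linear_statisticZ// covarianceZl//; [exact: Lfun1|exact: Lfun1|exact: LfunM].
Qed.

Lemma cov_sqrD f g : test f -> test g ->
  cov (f \+ g) (f \+ g) = cov f f + 2 * cov f g + cov g g.
Proof.
move=> tf tg; have tfg := testD tf tg.
rewrite covDl// (covC f (f \+ g)) (covC g (f \+ g)) !covDl// (covC g f).
by ring.
Qed.

Lemma cov_ge0 f : 0 <= cov f f.
Proof. by rewrite fine_ge0//; exact: variance_ge0. Qed.

Lemma covE f g : test f -> test g -> (cov f g)%:E =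
  ('E_P[linear_statistic f * linear_statistic g] -
   'E_P[linear_statistic f] * 'E_P[linear_statistic g])%E.
Proof.
move=> tf tg; rewrite EFin_cov// covarianceE//; [exact: Lfun1|exact: Lfun1|exact: LfunM].
Qed.

Lemma cov_indic_le0 (B C : set T) : measurable B -> measurable C ->
  bnd B -> bnd C -> B `&` C = set0 -> cov (\1_B) (\1_C) <= 0.
Proof.
move=> mB mC bB bC BC; have tB := test_indic mB bB; have tC := test_indic mC bC.
rewrite -lee_fin covE//.
rewrite sube_le0 unlock.
under eq_integral => xi _ do rewrite /= EFinM !linear_statistic_indic//.
under [X in (_ <= X * _)%E]eq_integral => xi _ do rewrite linear_statistic_indic//.
under [X in (_ <= _ * X)%E]eq_integral => xi _ do rewrite linear_statistic_indic//.
exact: negative_association.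
Qed.

(** A crude bound, linear in the height [M] of [u], which starts the halving
argument of the next lemma. *)
Lemma cov_le_bound (u v : T -> R) (S : set T) (M : R) : test u -> test v ->
  measurable S -> bnd S -> 0 <= M -> (forall x, u x <= M) ->
  (forall x, u x != 0 -> S x) ->
  cov u v <= M * fine 'E_P[linear_statistic (\1_S) * linear_statistic v].
Proof.
move=> tu tv mS bS M0 uM uS; have tS := test_indic mS bS.
have E0 : (0 <= 'E_P[linear_statistic u] * 'E_P[linear_statistic v])%E.
  by apply: mule_ge0; apply: expectation_ge0 => xi; exact: linear_statistic_ge0.
rewrite -lee_fin covE//.
apply: le_trans (_ : _ <= 'E_P[linear_statistic u * linear_statistic v])%E _.
  by rewrite leeBlDr ?leeDl// fin_numM// expectation_fin_num// Lfun1.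
rewrite EFinM fineK; last by rewrite expectation_fin_num// LfunM.
rewrite -expectationZl; last exact: LfunM.
have mY w : test w -> measurable_fun [set: N] (linear_statistic w).
  exact: measurable_linear_statistic.
apply: expectation_le.
- by apply: measurable_funM; exact: mY.
- by apply: measurable_funM => //; apply: measurable_funM; exact: mY.
- by move=> xi; rewrite mulr_ge0// linear_statistic_ge0.
- by move=> xi /=; rewrite !mulr_ge0// linear_statistic_ge0.
- apply: nearW => xi /=; rewrite [leRHS]mulrAC ler_wpM2r ?linear_statistic_ge0//.
  have /(congr1 (@^~ xi)) /= <- := linear_statisticZ M0 tS.
  apply: le_linear_statistic => // [|x /=]; first exact: testZ.
  have [->|ux] := eqVneq (u x) 0; first by rewrite indicE mulr_ge0.
  by rewrite indicE mem_set ?mul1r//; exact: uS.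
Qed.

(** If [u <= M], then [u] is [M / 2] times the indicator of the set where
[M / 2 <= u], plus a function of height at most [M / 2] with a smaller support.
The first part does not increase the covariance with [v], so halving [n] times
bounds the covariance by a constant times [M / 2 ^+ n]. *)
Lemma cov_le0_of_indic (v : T -> R) (S : set T) : test v -> measurable S -> bnd S ->
  (forall B, measurable B -> B `<=` S -> cov (\1_B) v <= 0) ->
  forall u, test u -> (forall x, u x != 0 -> S x) -> cov u v <= 0.
Proof.
move=> tv mS bS Sv u tu uS.
pose k := fine 'E_P[linear_statistic (\1_S) * linear_statistic v].
have halve n (w : T -> R) M : test w -> 0 <= M -> (forall x, w x <= M) ->
    (forall x, w x != 0 -> S x) -> cov w v <= M / 2 ^+ n * k.
  elim: n w M => [|n IHn] w M tw M0 wM wS.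
    by rewrite expr0 divr1; exact: cov_le_bound.
  have M20 : 0 <= M / 2 by rewrite divr_ge0.
  (* The second set matters only when M = 0: it keeps B inside S. *)
  pose B := [set x | M / 2 <= w x] `&` [set x | w x != 0].
  have [mw _ bw] := tw.
  have mB : measurable B.
    apply: measurableI; last exact: measurable_support.
    rewrite (_ : [set _ | _] = [set: T] `&` w @^-1` `[M / 2, +oo[); first exact: mw.
    by rewrite setTI; apply/seteqP; split => x /=; rewrite in_itv/= andbT.
  have BS : B `<=` S by move=> x [_ /wS].
  have tB : test (\1_B) by apply: test_indic => //; exact: bnd_sub BS bS.
  pose w' := w \- (M / 2) \o* \1_B.
  have ww' x : 0 <= w' x <= Num.min (w x) (M / 2).
    rewrite le_min /w' /= indicE; have w0 := test_ge0 x tw; have := wM x.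
    case: (boolP (x \in B)) => [/set_mem[/= Mw _]|xB] wMx.
      by rewrite mul1r; apply/and3P; split; lra.
    rewrite mul0r subr0 w0 lexx /=.
    have [->//|wx] := eqVneq (w x) 0.
    rewrite leNgt; apply: contra xB => Mw; apply: mem_set; split => //.
    exact: ltW.
  have tw' : test w'.
    apply: (test_le _ _ tw) => [|x].
      by apply: measurable_funB => //; apply: measurable_funM.
    by have /andP[-> ] := ww' x; rewrite le_min => /andP[].
  have -> : w = (M / 2) \o* \1_B \+ w'.
    by apply/funext => x; rewrite /w' /= addrC subrK.
  rewrite covDl//; last exact: testZ.
  rewrite covZl//.
  have : cov w' v <= (M / 2) / 2 ^+ n * k.
    apply: IHn => // x.
      by have /andP[_] := ww' x; rewrite le_min => /andP[].
    move=> w'x; apply: wS; apply: contra_neq w'x => wx.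
    by have := ww' x; rewrite le_min wx => /and3P[? ? _]; apply/le_anti/andP.
  rewrite -[M / 2 / _]mulrA -invfM -exprS => h.
  rewrite -[leRHS]add0r lerD//.
  by rewrite mulr_ge0_le0// Sv.
have [_ [M uM] _] := tu.
have M0 : 0 <= M by have /andP[/le_trans h /h] := uM point.
rewrite leNgt; apply/negP => uv0.
have := halve (Num.truncn (M * k / cov u v)).+1 u M tu M0 _ uS.
have hM x : u x <= M by have /andP[] := uM x.
move=> /(_ hM); set n := (Num.truncn _).+1.
apply/negP; rewrite -ltNge mulrAC ltr_pdivrMr ?exprn_gt0//.
rewrite [X in _ < X]mulrC -ltr_pdivrMr//.
apply: (@lt_trans _ _ n%:R); first exact: truncnS_gt.
by rewrite -natrX ltr_nat; exact: ltn_expl.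
Qed.

Lemma cov_le0 (u v : T -> R) : test u -> test v -> (forall x, u x * v x = 0) ->
  cov u v <= 0.
Proof.
move=> tu tv uv; have [mu _ bu] := tu; have [mv _ bv] := tv.
apply: (@cov_le0_of_indic v [set x | u x != 0]) => //.
  exact: measurable_support.
move=> B mB Bu; have bB := bnd_sub Bu bu; rewrite covC.
apply: (@cov_le0_of_indic (\1_B) [set x | v x != 0]) => //.
- exact: test_indic.
- exact: measurable_support.
move=> C mC Cv; apply: cov_indic_le0 => //; first exact: bnd_sub Cv bv.
rewrite -subset0 => x [/Cv /= vx /Bu /= ux].
by have /eqP := uv x; rewrite mulf_eq0 (negbTE vx) (negbTE ux).
Qed.

(** Take [F] of small variance that equals 1 on [S].  Since [F - \1_S] is
supported off [S], [cov h F <= cov h \1_S], and [cov h F] is small by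
Cauchy-Schwarz. *)
Lemma cov_indic_ge0 (h : T -> R) (S : set T) : test h -> measurable S -> bnd S ->
  (forall x, h x != 0 -> S x) -> 0 <= cov h (\1_S).
Proof.
move=> th mS bS hS; have tS := test_indic mS bS.
rewrite leNgt; apply/negP => hS0.
(* Cauchy-Schwarz is used as nonnegativity of the variance of t h + F; this t
   makes t^2 cov h h at most t b, so a variance of F below t b is absurd. *)
pose b := - cov h (\1_S); pose t := b / (cov h h + 1).
have b0 : 0 < b by rewrite oppr_gt0.
have h0 := cov_ge0 h.
have t0 : 0 < t by rewrite divr_gt0// ltr_wpDl.
have e0 : 0 < t * b by rewrite mulr_gt0.
have [F [tF FS VF]] := small_variance e0 mS bS.
have [mF _ _] := tF.
have F1 x : \1_S x <= F x.
  rewrite indicE; case: (boolP (x \in S)) => [/set_mem/FS->//|_].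
  exact: test_ge0 tF.
have tG : test (F \- \1_S).
  apply: (test_le _ _ tF) => [|x /=].
    by apply: measurable_funB => //; exact: measurable_indic.
  by rewrite subr_ge0 F1/= lerBlDr lerDl indicE.
have hG : cov h (F \- \1_S) <= 0.
  apply: cov_le0 => // x /=; have [->|hx] := eqVneq (h x) 0; first by rewrite mul0r.
  by rewrite FS ?indicE ?mem_set ?subrr ?mulr0//; exact: hS.
have hF : cov h F <= - b.
  rewrite (_ : F = (F \- \1_S) \+ \1_S); last by apply/funext => x /=; rewrite subrK.
  by rewrite covC covDl// covC [X in _ + X]covC opprK -[leRHS]add0r lerD.
have tth : test (t \o* h) by apply: testZ => //; exact: ltW.
have := cov_ge0 (t \o* h \+ F).
have t0w := ltW t0.
rewrite cov_sqrD// !covZl// (covC h (t \o* h)) covZl//.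
move: VF; rewrite /variance -EFin_cov// lte_fin => VF.
have tb : t * (cov h h + 1) = b by rewrite /t divfK// gt_eqF// ltr_wpDl.
apply/negP; rewrite -ltNge; nra.
Qed.

(** With [g = min f 1], [h = f - g] and [S] the support of [f], the functions
[h] and [\1_S - g] have disjoint supports, as [g = 1] wherever [h != 0].  Hence
[cov g h >= cov \1_S h >= 0], and expanding the variance of [g + h] concludes. *)
Lemma variance_truncate (f : T -> R) : test f ->
  cov (fun x => Num.min (f x) 1) (fun x => Num.min (f x) 1) <= cov f f.
Proof.
move=> tf; have [mf _ bf] := tf.
pose g x := Num.min (f x) 1; pose h := f \- g.
pose S := [set x | f x != 0]; pose r := \1_S \- g.
have mS : measurable S by exact: measurable_support.
have tS : test (\1_S) by exact: test_indic.
have mg : measurable_fun [set: T] g by apply: measurable_minr.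
have g0 x : 0 <= g x by rewrite le_min ler01 (test_ge0 _ tf).
have gf x : g x <= f x by rewrite ge_min lexx.
have g1 x : g x <= 1 by rewrite ge_min lexx orbT.
have tg : test g by apply: (test_le _ _ tf) => // x; rewrite g0 gf.
have th : test h.
  apply: (test_le _ _ tf) => [|x]; first exact: measurable_funB.
  by rewrite /h /= subr_ge0 gf lerBlDr lerDl g0.
have tr : test r.
  apply: (test_le _ _ tS) => [|x].
    by apply: measurable_funB => //; exact: measurable_indic.
  rewrite /r /= lerBlDr lerDl g0 andbT subr_ge0 indicE.
  case: (boolP (x \in S)) => [//|]; rewrite notin_setE /S /= => /negP.
  by rewrite negbK => /eqP fx; rewrite mulr0n -fx gf.
have rh : cov r h <= 0.
  apply: cov_le0 => // x; rewrite /r /h /= /g.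
  have [f1|f1] := leP (f x) 1; first by rewrite subrr mulr0.
  by rewrite indicE mem_set ?subrr ?mul0r// /S /= gt_eqF// (lt_trans ltr01).
have hS : 0 <= cov h (\1_S).
  apply: cov_indic_ge0 => // x; apply: contra_neq => fx.
  by rewrite /h /g /= fx min_l ?subrr.
have gh : 0 <= cov g h.
  have : cov (r \+ g) h = cov r h + cov g h by exact: covDl.
  have -> : r \+ g = \1_S by apply/funext => x; rewrite /r /= subrK.
  by rewrite (covC _ h) => rgh; lra.
have fgh : f = g \+ h by apply/funext => x; rewrite /h /= addrC subrK.
rewrite [leRHS](_ : _ = cov g g + 2 * cov g h + cov h h).
  by have := cov_ge0 h; rewrite -/g; lra.
by rewrite -cov_sqrD// -fgh.
Qed.

Lemma small_variance_le1 (eps : R) (B : set T) : 0 < eps -> measurable B -> bnd B ->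
  exists f : T -> R, [/\ measurable_fun [set: T] f, forall x, 0 <= f x <= 1,
    bnd [set x | f x != 0], forall x, B x -> f x = 1 &
    ('V_P[linear_statistic f] < eps%:E)%E].
Proof.
move=> e0 mB bB; have [f [tf fB Vf]] := small_variance e0 mB bB.
have [mf [M fM] bf] := tf.
have tg : test (fun x => Num.min (f x) 1).
  apply: (test_le _ _ tf) => [|x]; first by apply: measurable_minr.
  by rewrite le_min ler01 (test_ge0 _ tf) ge_min lexx.
exists (fun x => Num.min (f x) 1); split.
- by case: tg.
- by move=> x; rewrite le_min ler01 (test_ge0 _ tf) ge_min lexx orbT.
- by case: tg.
- by move=> x /fB ->; rewrite minxx.
- apply: le_lt_trans Vf; rewrite /variance -!EFin_cov// lee_fin.
  exact: variance_truncate.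
Qed.
End covariance.

(** * Integrals over rectangles *)
Section ae_le.
Context d (T : measurableType d) (R : realType) (mu : {measure set T -> \bar R}).
Local Open Scope ereal_scope.

(** The functions have no sign and their integrals may be infinite, so the
positive and negative parts are compared separately. *)
Lemma ae_le_integral (D : set T) (f g : T -> \bar R) : measurable D ->
  measurable_fun D f -> measurable_fun D g ->
  {ae mu, forall x, D x -> f x <= g x} ->
  \int[mu]_(x in D) f x <= \int[mu]_(x in D) g x.
Proof.
move=> mD mf mg fg; rewrite integralE [leRHS]integralE; apply: leeB.
- apply: ae_ge0_le_integral => //.
  + exact: measurable_funepos.
  + exact: measurable_funepos.
  + by apply: filterS fg => x fg /fg fgx; rewrite !funeposE ge_max !le_max fgx lexx orbT.
- apply: ae_ge0_le_integral => //.
  + exact: measurable_funeneg.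
  + exact: measurable_funeneg.
  + by apply: filterS fg => x fg /fg fgx; rewrite !funenegE ge_max !le_max leeN2 fgx lexx orbT.
Qed.

End ae_le.

Lemma fine_subC (R : realType) (a b : \bar R) : fine (a - b)%E = - fine (b - a)%E.
Proof. by case: a => [a||]; case: b => [b||] //=; rewrite ?oppr0// opprB. Qed.

(** When the integral is infinite or of the form [oo - oo], both sides are 0. *)
Lemma RintegralN d (T : measurableType d) (R : realType)
    (mu : {measure set T -> \bar R}) (D : set T) (f : T -> R) :
  (\int[mu]_(x in D) - f x)%R = - (\int[mu]_(x in D) f x)%R.
Proof.
rewrite /Rintegral integralE [X in _ = - fine X]integralE fine_subC.
congr (- fine (_ - _)%E); apply: eq_integral => x _.
  by rewrite funenegE funeposE /= opprK.
by rewrite funenegE funeposE /=.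
Qed.
Section product_null.
Context d (T : measurableType d) (R : realType) (mu : {sigma_finite_measure set T -> \bar R}).
Local Open Scope ereal_scope.

(** The measurable sets over which [h] has integral 0 form a Dynkin system, and
rectangles are stable under intersection. *)
Lemma integral_rectangles_eq0 (A B : set T) (h : T * T -> \bar R) :
  measurable A -> measurable B -> (mu \x mu).-integrable (A `*` B) h ->
  (forall C D, measurable C -> measurable D -> C `<=` A -> D `<=` B ->
    \int[mu \x mu]_(p in C `*` D) h p = 0) ->
  ae_eq (mu \x mu) (A `*` B) h (cst 0).
Proof.
move=> mA mB ih h0; have mAB : measurable (A `*` B) by exact: measurableX.
have mh := measurable_int _ ih.
apply: integral_ae_eq => // E EAB mE; rewrite integral0.
have -> : E = E `&` (A `*` B) by rewrite setIidl.
have iE S : measurable S -> (mu \x mu).-integrable (S `&` (A `*` B)) h.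
  by move=> mS; apply: integrableS ih => //; exact: measurableI.
move: mE; rewrite measurable_prod_measurableType; move: E {EAB}.
apply: (@dynkin_induction _ (T * T)%type _
  [set E | \int[mu \x mu]_(x in E `&` (A `*` B)) h x = 0]).
- exact: measurable_prod_measurableType.
- move=> _ _ [A1 mA1 [B1 mB1 <-]] [A2 mA2 [B2 mB2 <-]]; rewrite -setXI.
  by exists (A1 `&` A2); [exact: measurableI|exists (B1 `&` B2) => //; exact: measurableI].
- by rewrite /= setTI; exact: h0.
- move=> _ [C mC [D mD <-]] /=; rewrite -setXI.
  by apply: h0; [exact: measurableI|exact: measurableI|exact: subIsetr|exact: subIsetr].
- move=> S mS /= S0.
  have := h0 _ _ mA mB (@subset_refl _ _) (@subset_refl _ _).
  rewrite -[X in \int[_]_(_ in X) _](setTI (A `*` B)) -(setUv S) setIUl integral_setU//.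
  + by rewrite S0 add0e.
  + exact: measurableI.
  + by apply: measurableI => //; exact: measurableC.
  + by rewrite -setIUl setUv setTI.
  + by rewrite /disj_set setIACA setICr set0I eqxx.
- move=> F mF tF F0 /=; rewrite setI_bigcupl integral_bigcup//.
  + by under eq_eseriesr do rewrite F0; rewrite eseries0.
  + by apply/trivIsetP => i j _ _ ij; rewrite setIACA (trivIsetP.1 tF)// set0I.
  + by move=> k; exact: measurableI.
  + by rewrite -setI_bigcupl; apply: iE; exact: bigcupT_measurable.
Qed.

Section rectangle.
Variables (A B : set T) (h : T * T -> \bar R).
Hypotheses (mA : measurable A) (mB : measurable B)
  (ih : (mu \x mu).-integrable (A `*` B) h).

Let ih' : (mu \x mu).-integrable [set: T * T] (h \_ (A `*` B)).
Proof. by apply/(integrable_mkcond _ _).1 => //; exact: measurableX. Qed.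

Lemma integral_rectangle12 :
  \int[mu \x mu]_(p in A `*` B) h p = \int[mu]_(x in A) \int[mu]_(y in B) h (x, y).
Proof.
rewrite integral_mkcond -(integral12_prod_meas1 ih') [RHS]integral_mkcond.
apply: eq_integral => x _; rewrite /fubini_F patchE; case: ifPn => xA.
  rewrite [RHS]integral_mkcond; apply: eq_integral => y _.
  by rewrite !patchE in_setX xA.
by rewrite integral0_eq// => y _; rewrite patchE in_setX (negbTE xA).
Qed.

Lemma integral_rectangle21 :
  \int[mu \x mu]_(p in A `*` B) h p = \int[mu]_(y in B) \int[mu]_(x in A) h (x, y).
Proof.
rewrite integral_mkcond -(integral21_prod_meas1 ih') [RHS]integral_mkcond.
apply: eq_integral => y _; rewrite /fubini_G patchE; case: ifPn => yB.
  rewrite [RHS]integral_mkcond; apply: eq_integral => x _.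
  by rewrite !patchE in_setX yB andbT.
by rewrite integral0_eq// => x _; rewrite patchE in_setX (negbTE yB) andbF.
Qed.

End rectangle.

Lemma integrable_swap (A : set T) (u : T * T -> R) : measurable A ->
  measurable_fun [set: T * T] u ->
  (mu \x mu).-integrable (A `*` A) (EFin \o u) ->
  (mu \x mu).-integrable (A `*` A) (fun p => (u (p.2, p.1))%:E).
Proof.
move=> mA mu_ /integrableP[_ iu]; have mAA : measurable (A `*` A) by exact: measurableX.
have mswap : measurable_fun [set: T * T] (fun p : T * T => (p.2, p.1)).
  exact: measurable_fun_pair.
apply/integrableP; split.
  by apply: measurable_funTS; apply/measurable_EFinP; exact: measurableT_comp mswap.
move: iu; rewrite integral_mkcond [X in _ -> X < _]integral_mkcond.
have m1 : measurable_fun [set: T * T] ((abse \o (EFin \o u)) \_ (A `*` A)).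
  apply/(measurable_restrictT _ _).1 => //; apply: measurable_funTS.
  by apply: measurableT_comp => //; exact/measurable_EFinP.
have m2 : measurable_fun [set: T * T] ((abse \o (fun p => (u (p.2, p.1))%:E)) \_ (A `*` A)).
  apply/(measurable_restrictT _ _).1 => //; apply: measurable_funTS.
  by apply: measurableT_comp => //; apply/measurable_EFinP; exact: measurableT_comp mswap.
have ge0 f p : 0 <= ((abse \o f) \_ (A `*` A)) p :> \bar R.
  by rewrite patchE; case: ifP => _ //; exact: abse_ge0.
have e1 := fubini_tonelli1 _ m1 (ge0 _).
have e2 := fubini_tonelli2 _ m2 (ge0 _).
apply: le_lt_trans; rewrite [leLHS]e2 [leRHS]e1 /fubini_F /fubini_G.
rewrite le_eqVlt; apply/orP; left; apply/eqP.
apply: eq_integral => x _; apply: eq_integral => y _.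
by rewrite !patchE !in_setX andbC.
Qed.

(** The function [u (x, y) - s * u (y, x)] has integral 0 over every rectangle
in [G `*` G].  With [s] equal to 1 or -1 this gives the symmetry of the real
part of a Hermitian kernel and the antisymmetry of its imaginary part. *)
Lemma ae_eq_swap (G : set T) (u : T * T -> R) (s : R) : measurable G ->
  measurable_fun [set: T * T] u ->
  (mu \x mu).-integrable (G `*` G) (EFin \o u) ->
  (forall C D, measurable C -> measurable D -> C `<=` G -> D `<=` G ->
    \int[mu]_(x in D) \int[mu]_(y in C) (u (x, y))%:E =
    s%:E * \int[mu]_(x in C) \int[mu]_(y in D) (u (x, y))%:E) ->
  {ae mu, forall x, G x -> {ae mu, forall y, G y -> u (x, y) = (s * u (y, x))%R}}.
Proof.
move=> mG mu_ iu uG; have mGG : measurable (G `*` G) by exact: measurableX.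
have iv := integrable_swap mG mu_ iu.
pose v : T * T -> \bar R := fun p => (u (p.2, p.1))%:E.
pose h : T * T -> \bar R := fun p => (u p)%:E - s%:E * v p.
have isv : (mu \x mu).-integrable (G `*` G) (fun p => s%:E * v p).
  exact: integrableZl.
have ih : (mu \x mu).-integrable (G `*` G) h by exact: integrableB.
have h0 : ae_eq (mu \x mu) (G `*` G) h (cst 0).
  apply: integral_rectangles_eq0 => // D C mD mC DG CG.
  have iDC w : (mu \x mu).-integrable (G `*` G) w -> (mu \x mu).-integrable (D `*` C) w.
    by apply: integrableS => //; [exact: measurableX|move=> [x y] /= [/DG ? /CG]].
  have mDC : measurable (D `*` C) by exact: measurableX.
  have uv : \int[mu \x mu]_(p in D `*` C) (u p)%:E =
      s%:E * \int[mu \x mu]_(p in D `*` C) v p.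
    rewrite integral_rectangle12//; last exact: iDC.
    by rewrite uG// integral_rectangle21//; exact: iDC.
  rewrite integralB//; [|exact: iDC|exact: iDC].
  rewrite integralZl//; last exact: iDC.
  by rewrite -uv subee// integrable_fin_num//; exact: iDC.
pose w := (abse \o h) \_ (G `*` G).
have mw : measurable_fun [set: T * T] w.
  apply/(measurable_restrictT _ _).1 => //.
  by apply: measurableT_comp => //; exact: measurable_int ih.
have w0 p : 0 <= w p by rewrite /w patchE; case: ifP => _ //=; exact: abse_ge0.
have int0 : \int[mu]_x \int[mu]_y w (x, y) = 0.
  rewrite -fubini_tonelli1// -integral_mkcond.
  by apply/ae_eq_integral_abs => //; exact: measurable_int ih.
have mW : measurable_fun [set: T] (fun x => \int[mu]_y w (x, y)).
  exact: measurable_fun_fubini_tonelli_F.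
have /(ae_eq_integral_abs _ measurableT mW) :
    \int[mu]_x `|\int[mu]_y w (x, y)| = 0.
  by rewrite -[RHS]int0; apply: eq_integral => x _; rewrite gee0_abs// integral_ge0.
apply: filterS => x /(_ I) /= wx0 Gx.
have mwx : measurable_fun [set: T] (fun y => w (x, y)).
  exact: measurableT_comp mw (pair1_measurable x).
have /(ae_eq_integral_abs _ measurableT mwx) : \int[mu]_y `|w (x, y)| = 0.
  by rewrite -[RHS]wx0; apply: eq_integral => y _; rewrite gee0_abs.
apply: filterS => y /(_ I) + Gy; rewrite /w patchE mem_set//= => /eqP.
by rewrite eqe normr_eq0 subr_eq0 => /eqP.
Qed.

End product_null.

(** * Kernels of self-adjoint operators *)
Section complex_parts.
Context (R : realType).
Implicit Types z w : R[i].

Lemma Re_conj_mul z w : complex.Re (z * conjc w) =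
  complex.Re z * complex.Re w + complex.Im z * complex.Im w.
Proof. by case: z => a b; case: w => a' b' /=; ring. Qed.

Lemma Im_conj_mul z w : complex.Im (z * conjc w) =
  complex.Im z * complex.Re w - complex.Re z * complex.Im w.
Proof. by case: z => a b; case: w => a' b' /=; ring. Qed.

Lemma Re_mul z w : complex.Re (z * w) =
  complex.Re z * complex.Re w - complex.Im z * complex.Im w.
Proof. by case: z => a b; case: w => a' b' /=. Qed.

Lemma Im_mul z w : complex.Im (z * w) =
  complex.Re z * complex.Im w + complex.Im z * complex.Re w.
Proof. by case: z => a b; case: w => a' b' /=. Qed.

Lemma Re_indic (T : Type) (C : set T) x : complex.Re (\1_C x : R[i]) = \1_C x.
Proof. by rewrite !indicE; case: (_ \in _). Qed.

Lemma Im_indic (T : Type) (C : set T) x : complex.Im (\1_C x : R[i]) = 0.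
Proof. by rewrite !indicE; case: (_ \in _). Qed.

End complex_parts.

Section section_integral.
Context d (T : measurableType d) (R : realType) (mu : {sigma_finite_measure set T -> \bar R}).
Local Open Scope ereal_scope.

Lemma measurable_section_integral (C : set T) (k : T * T -> R) : measurable C ->
  measurable_fun [set: T * T] k ->
  measurable_fun [set: T] (fun x => \int[mu]_(y in C) (k (x, y))%:E).
Proof.
move=> mC mk.
have mf : measurable_fun [set: T * T] ((EFin \o k) \_ ([set: T] `*` C)).
  apply/(measurable_restrictT _ _).1; first exact: measurableX.
  by apply: measurable_funTS; exact/measurable_EFinP.
set f := _ \_ _ in mf.
rewrite (_ : (fun x => _) = (fun x =>
    \int[mu]_y f^\+ (x, y) - \int[mu]_y f^\- (x, y))); last first.
  apply/funext => x; rewrite integral_mkcond.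
  rewrite (_ : _ \_ C = (fun y => f (x, y))).
    rewrite integralE; congr (_ - _); apply: eq_integral => y _.
      by rewrite !funeposE.
    by rewrite !funenegE.
  by apply/funext => y; rewrite /f !patchE in_setX in_setT.
apply: emeasurable_funB.
- apply: (measurable_fun_fubini_tonelli_F (f^\+)) => //; exact: measurable_funepos.
- apply: (measurable_fun_fubini_tonelli_F (f^\-)) => //; exact: measurable_funeneg.
Qed.

(** For [k] the real or imaginary part of a kernel and [a] that of the image of
[\1_C], this computes the corresponding part of the inner product of that image
with [\1_D]. *)
Lemma integral_kernel_operator (C D : set T) (a : T -> R) (k : T * T -> R) :
  measurable C -> measurable D -> measurable_fun [set: T] a ->
  measurable_fun [set: T * T] k ->
  {ae mu, forall x, mu.-integrable C (fun y => (k (x, y))%:E) /\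
    a x = (\int[mu]_(y in C) k (x, y))%R} ->
  \int[mu]_x (a x * \1_D x)%:E =
  \int[mu]_(x in D) \int[mu]_(y in C) (k (x, y))%:E.
Proof.
move=> mC mD ma mk ak.
transitivity (\int[mu]_(x in D) (a x)%:E).
  rewrite [RHS]integral_mkcond; apply: eq_integral => x _.
  by rewrite patchE indicE; case: ifP => _; rewrite ?mulr1 ?mulr0.
apply: ae_eq_integral => //.
- by apply: measurable_funTS; exact/measurable_EFinP.
- by apply: measurable_funTS; exact: measurable_section_integral.
- by apply: filterS ak => x [ik ->] _; rewrite fineK// integrable_fin_num.
Qed.

End section_integral.

Section kernel.
Context d (T : measurableType d) (R : realType) (bnd : set (set T)).
Variable mu : {sigma_finite_measure set T -> \bar R}.
Variable E : nat -> set T.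
Hypotheses (mE : forall k, measurable (E k)) (bE : forall k, bnd (E k))
  (ndE : nondecreasing_seq E) (UE : \bigcup_k E k = [set: T]).
Hypothesis bnd_sub : forall A B : set T, A `<=` B -> bnd B -> bnd A.
Hypothesis mu_lfin : forall B, measurable B -> bnd B -> (mu B < +oo)%E.
Variables (A : (T -> R[i]) -> (T -> R[i])) (K : T -> T -> R[i]).
Hypotheses (projA : orthogonal_projection mu A)
  (ltcA : locally_trace_class mu bnd A)
  (kerA : has_kernel mu A K)
  (diagK : trace_diagonal mu bnd A K).

Let mReK : measurable_fun [set: T * T] (fun p => complex.Re (K p.1 p.2)).
Proof. by case: kerA => -[]. Qed.

Let mImK : measurable_fun [set: T * T] (fun p => complex.Im (K p.1 p.2)).
Proof. by case: kerA => -[]. Qed.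

Lemma L2_indic (C : set T) : measurable C -> (mu C < +oo)%E ->
  L2 mu (\1_C : T -> R[i]).
Proof.
move=> mC C_oo; split; first split.
- by under eq_fun do rewrite Re_indic; exact: measurable_indic.
- by under eq_fun do rewrite Im_indic; exact: measurable_cst.
- under eq_integral do rewrite Re_indic Im_indic expr0n addr0 indicE -natrX -mulnn mulnb andbb.
  by rewrite integral_indic// setIT.
Qed.

Lemma L2dotC (f g : T -> R[i]) : L2dot mu f g = conjc (L2dot mu g f).
Proof.
rewrite /L2dot /cintegral /=; congr Complex.
  by apply: eq_Rintegral => x _; rewrite !Re_conj_mul; ring.
rewrite -RintegralN; apply: eq_Rintegral => x _; rewrite !Im_conj_mul; ring.
Qed.

(** Applied to indicators, [has_kernel] says that almost every section of the
kernel is integrable over sets of finite measure. *)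
Lemma kernel_indic (C : set T) : measurable C -> (mu C < +oo)%E ->
  {ae mu, forall x,
    [/\ mu.-integrable C (fun y => (complex.Re (K x y))%:E),
        mu.-integrable C (fun y => (complex.Im (K x y))%:E),
        complex.Re (A (\1_C) x) = (\int[mu]_(y in C) complex.Re (K x y))%R &
        complex.Im (A (\1_C) x) = (\int[mu]_(y in C) complex.Im (K x y))%R]}.
Proof.
move=> mC C_oo; have [_ /(_ _ (L2_indic mC C_oo))] := kerA.
apply: filterS => x [[iRe iIm] ->].
have Re1 y : complex.Re (K x y * \1_C y) = ((fun y => complex.Re (K x y)) \_ C) y.
  rewrite Re_mul Re_indic Im_indic mulr0 subr0 patchE indicE.
  by case: ifP => _; rewrite ?mulr1 ?mulr0.
have Im1 y : complex.Im (K x y * \1_C y) = ((fun y => complex.Im (K x y)) \_ C) y.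
  rewrite Im_mul Re_indic Im_indic mulr0 add0r patchE indicE.
  by case: ifP => _; rewrite ?mulr1 ?mulr0.
split.
- apply/(integrable_mkcond _ _).2 => //; apply: eq_integrable iRe => // y _.
  by rewrite Re1 !patchE; case: ifP.
- apply/(integrable_mkcond _ _).2 => //; apply: eq_integrable iIm => // y _.
  by rewrite Im1 !patchE; case: ifP.
- by rewrite /= [RHS]Rintegral_mkcond; apply: eq_Rintegral => y _.
- by rewrite /= [RHS]Rintegral_mkcond; apply: eq_Rintegral => y _.
Qed.

Lemma L2dot_indic (C D : set T) : measurable C -> measurable D ->
  (mu C < +oo)%E -> (mu D < +oo)%E ->
  complex.Re (L2dot mu (A (\1_C)) (\1_D)) =
    fine (\int[mu]_(x in D) \int[mu]_(y in C) (complex.Re (K x y))%:E)%E /\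
  complex.Im (L2dot mu (A (\1_C)) (\1_D)) =
    fine (\int[mu]_(x in D) \int[mu]_(y in C) (complex.Im (K x y))%:E)%E.
Proof.
move=> mC mD C_oo D_oo.
have [[/(_ _ (L2_indic mC C_oo)) [[mRe mIm] _] _ _ _] _ _] := projA.
split.
- rewrite -(@integral_kernel_operator _ _ _ mu C D _ (fun p => complex.Re (K p.1 p.2)) mC mD mRe)//.
    congr fine; apply: eq_integral => x _.
    by rewrite Re_conj_mul Re_indic Im_indic mulr0 addr0.
  by apply: filterS (kernel_indic mC C_oo) => x [].
- rewrite -(@integral_kernel_operator _ _ _ mu C D _ (fun p => complex.Im (K p.1 p.2)) mC mD mIm)//.
    congr fine; apply: eq_integral => x _.
    by rewrite Im_conj_mul Re_indic Im_indic mulr0 subr0.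
  by apply: filterS (kernel_indic mC C_oo) => x [].
Qed.

(** The kernel need not be integrable on [E n `*` E n], as only almost all of
its sections are known to be integrable on [E n].  It is integrable on the square
of each [G n m], where the integrals of the sections are at most [m], and these
sets exhaust [E n] up to a null set. *)
Let phi n x := (\int[mu]_(y in E n)
  (`|complex.Re (K x y)| + `|complex.Im (K x y)|)%:E)%E.

Let G n m := E n `&` [set x | (phi n x <= m%:R%:E)%E].

Let mabsK : measurable_fun [set: T * T]
  (fun p => `|complex.Re (K p.1 p.2)| + `|complex.Im (K p.1 p.2)|).
Proof. by apply: measurable_funD; apply: measurableT_comp. Qed.

Let mG n m : measurable (G n m).
Proof.
apply: measurableI => //; rewrite -[X in measurable X]setTI.
apply: measurable_lee => //.
exact: (@measurable_section_integral _ _ _ mu (E n) _ (mE n) mabsK).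
Qed.

Let bG n m : bnd (G n m).
Proof. by apply: bnd_sub (bE n) => x []. Qed.

Let G_cover : {ae mu, forall x n, E n x -> exists M, forall m, (M <= m)%N -> G n m x}.
Proof.
apply: ae_foralln => n.
apply: filterS (kernel_indic (mE n) (mu_lfin (mE n) (bE n))) => x [iRe iIm _ _] Enx.
have : phi n x \is a fin_num.
  rewrite ge0_fin_numE ?integral_ge0//.
  have /integrableP[_] := integrableD (mE n) (integrable_norm iRe) (integrable_norm iIm).
  apply: le_lt_trans; rewrite le_eqVlt; apply/orP; left; apply/eqP.
  apply: eq_integral => y _; rewrite gee0_abs; first exact: EFinD.
  by apply: adde_ge0; rewrite /= lee_fin.
move=> phifin; exists (Num.truncn (fine (phi n x))).+1 => m mx; split => //=.
rewrite -(fineK phifin) lee_fin; apply/ltW/(lt_le_trans (truncnS_gt _)).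
by rewrite ler_nat.
Qed.

Let integrableG n m (u : T * T -> R) : measurable_fun [set: T * T] u ->
  (forall x y, `|u (x, y)| <= `|complex.Re (K x y)| + `|complex.Im (K x y)|) ->
  (mu \x mu)%E.-integrable (G n m `*` G n m) (EFin \o u).
Proof.
move=> mu_ uK; have mGG : measurable (G n m `*` G n m) by exact: measurableX.
have mu1 : measurable_fun [set: T * T] (EFin \o u) by exact/measurable_EFinP.
have mF : measurable_fun [set: T * T] ((abse \o (EFin \o u)) \_ (G n m `*` G n m)).
  by apply/(measurable_restrictT _ _).1 => //; apply: measurable_funTS; exact: measurableT_comp.
apply/integrableP; split; first exact: measurable_funTS.
rewrite integral_mkcond fubini_tonelli1//; last by move=> p; rewrite patchE; case: ifP.
have mGn : (mu (G n m) < +oo)%E by exact: mu_lfin.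
apply: (@le_lt_trans _ _ (\int[mu]_(x in G n m) (m%:R)%:E)%E); last first.
  by rewrite integral_cst// lte_mul_pinfty// lee_fin.
rewrite [leRHS]integral_mkcond; apply: ge0_le_integral => //.
- by move=> x _; apply: integral_ge0 => y _; rewrite patchE; case: ifP.
- apply: measurable_fun_fubini_tonelli_F => //.
  by move=> p; rewrite patchE; case: ifP.
- by apply/(measurable_restrictT _ _).1 => //; exact: measurable_cst.
move=> x _; rewrite /fubini_F patchE; case: ifPn => xG; last first.
  by rewrite integral0_eq// => y _; rewrite patchE in_setX (negbTE xG).
have [_ /= +] := set_mem xG; apply: le_trans.
rewrite /phi [leRHS]integral_mkcond; apply: ge0_le_integral => //.
- by move=> y _; rewrite patchE; case: ifP.
- exact: measurableT_comp mF (pair1_measurable x).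
- apply/(measurable_restrictT _ _).1 => //; apply: measurable_funTS.
  by apply/measurable_EFinP; exact: measurableT_comp mabsK (pair1_measurable x).
- move=> y _; rewrite !patchE in_setX xG /=; case: ifPn => [/set_mem[Ey _]|_].
    by rewrite mem_set// lee_fin uK.
  by case: ifP => // _; rewrite lee_fin addr_ge0.
Qed.

Lemma L2dot_indicC (C D : set T) : measurable C -> measurable D ->
  (mu C < +oo)%E -> (mu D < +oo)%E ->
  L2dot mu (A (\1_C)) (\1_D) = conjc (L2dot mu (A (\1_D)) (\1_C)).
Proof.
move=> mC mD C_oo D_oo; have [_ _ Asym] := projA.
by rewrite Asym; [exact: L2dotC|exact: L2_indic|exact: L2_indic].
Qed.

(** For [C] and [D] inside [G n m], self-adjointness tested on [\1_C] and [\1_D]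
says that the integrals of the kernel over [D `*` C] and [C `*` D] are conjugate
to each other, which forces [K y x] to be the conjugate of [K x y] almost
everywhere on that square. *)
Lemma kernel_hermitian :
  {ae mu, forall x, {ae mu, forall y, K y x = conjc (K x y)}}.
Proof.
have Goo n m (C : set T) : measurable C -> C `<=` G n m -> (mu C < +oo)%E.
  by move=> mC CG; apply: mu_lfin => //; exact: bnd_sub CG (bG n m).
have fin n m (u : T * T -> R) C D : measurable_fun [set: T * T] u ->
    (forall x y, `|u (x, y)| <= `|complex.Re (K x y)| + `|complex.Im (K x y)|) ->
    measurable C -> measurable D -> C `<=` G n m -> D `<=` G n m ->
    (\int[mu]_(x in D) \int[mu]_(y in C) (u (x, y))%:E)%E \is a fin_num.
  move=> mu_ uK mC mD CG DG.
  have iDC : (mu \x mu)%E.-integrable (D `*` C) (EFin \o u).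
    apply: integrableS (integrableG n m mu_ uK); [exact: measurableX|exact: measurableX|].
    by move=> [x y] /= [/DG ? /CG].
  have := integrable_fin_num (measurableX mD mC) iDC.
  by rewrite integral_rectangle12.
pose u1 (p : T * T) := complex.Re (K p.1 p.2).
pose u2 (p : T * T) := complex.Im (K p.1 p.2).
have u1K x y : `|u1 (x, y)| <= `|complex.Re (K x y)| + `|complex.Im (K x y)|.
  by rewrite lerDl.
have u2K x y : `|u2 (x, y)| <= `|complex.Re (K x y)| + `|complex.Im (K x y)|.
  by rewrite lerDr.
have HRe n m : {ae mu, forall x, G n m x -> {ae mu, forall y, G n m y ->
    u1 (x, y) = 1 * u1 (y, x)}}.
  apply: ae_eq_swap => //; first exact: integrableG.
  move=> C D mC mD CG DG; rewrite mul1e.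
  rewrite -(fineK (fin n m u1 C D mReK u1K mC mD CG DG)).
  rewrite -(fineK (fin n m u1 D C mReK u1K mD mC DG CG)); congr EFin.
  have [<- _] := L2dot_indic mC mD (Goo _ _ _ mC CG) (Goo _ _ _ mD DG).
  have [<- _] := L2dot_indic mD mC (Goo _ _ _ mD DG) (Goo _ _ _ mC CG).
  rewrite (L2dot_indicC mC mD (Goo _ _ _ mC CG) (Goo _ _ _ mD DG)).
  by case: (L2dot mu (A (\1_D)) (\1_C)).
have HIm n m : {ae mu, forall x, G n m x -> {ae mu, forall y, G n m y ->
    u2 (x, y) = -1 * u2 (y, x)}}.
  apply: ae_eq_swap => //; first exact: integrableG.
  move=> C D mC mD CG DG.
  rewrite -(fineK (fin n m u2 C D mImK u2K mC mD CG DG)).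
  rewrite -(fineK (fin n m u2 D C mImK u2K mD mC DG CG)).
  rewrite -EFinM mulN1r; congr EFin.
  have [_ <-] := L2dot_indic mC mD (Goo _ _ _ mC CG) (Goo _ _ _ mD DG).
  have [_ <-] := L2dot_indic mD mC (Goo _ _ _ mD DG) (Goo _ _ _ mC CG).
  rewrite (L2dot_indicC mC mD (Goo _ _ _ mC CG) (Goo _ _ _ mD DG)).
  by case: (L2dot mu (A (\1_D)) (\1_C)).
have H : {ae mu, forall x, forall n m, G n m x ->
    {ae mu, forall y, G n m y -> K y x = conjc (K x y)}}.
  apply: ae_foralln => n; apply: ae_foralln => m.
  apply: filterS2 (HRe n m) (HIm n m) => x xRe xIm xG.
  apply: filterS2 (xRe xG) (xIm xG) => y yRe yIm yG.
  move: (yRe yG) (yIm yG); rewrite /u1 /u2 /=.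
  by case: (K x y) => a b; case: (K y x) => a' b' /= -> ->; rewrite mul1r mulN1r opprK.
apply: filterS2 G_cover H => x xG xH.
have {}xH : {ae mu, forall y, forall n m, G n m x -> G n m y -> K y x = conjc (K x y)}.
  apply: ae_foralln => n; apply: ae_foralln => m.
  have [xnm|xnm] := pselect (G n m x); last exact: nearW.
  by apply: filterS (xH _ _ xnm) => y + _; apply.
apply: filterS2 G_cover xH => y yG xyH.
(* First n puts both points in E n, then m is large enough for both. *)
have [i _ Eix] : (\bigcup_k E k) x by rewrite UE.
have [j _ Ejy] : (\bigcup_k E k) y by rewrite UE.
pose n := maxn i j.
have Enx : E n x by move: x Eix {xG xyH}; exact/subsetPset/ndE/leq_maxl.
have Eny : E n y by move: y Ejy {yG xyH}; exact/subsetPset/ndE/leq_maxr.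
have [M1 xM] := xG _ Enx; have [M2 yM] := yG _ Eny.
apply: (xyH n (maxn M1 M2)); first by apply: xM; exact: leq_maxl.
by apply: yM; exact: leq_maxr.
Qed.

(** Being locally trace class provides an orthonormal basis, along which the
trace of the compression is a sum of numbers [L2dot (A f) f], all of them real. *)
Lemma trace_diagonal_real (B : set T) : measurable B -> bnd B ->
  (\int[mu]_(x in B) complex.Im (K x x))%R = 0.
Proof.
move=> mB bB; have [_ [S [I [e [_ bas _]]]]] := ltcA mB bB.
have [_ /(_ I e bas) /= [_]] := diagK mB bB.
have [eL2 _ _] := bas.
have [_ _ Asym] := projA.
rewrite (_ : (fun n => _) = cst 0); last first.
  apply/funext => n; apply: (big_ind (fun z : R[i] => complex.Im z = 0)) => //.
    by move=> [a b] [a' b'] /= -> ->; rewrite addr0.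
  move=> i Ii.
  pose f : T -> R[i] := fun x => \1_B x * e i x.
  have fL2 : L2 mu f.
    have [[mr mi] eoo] := eL2 i Ii.
    have fRe x : complex.Re (f x) = \1_B x * complex.Re (e i x).
      by rewrite /f Re_mul Re_indic Im_indic mul0r subr0.
    have fIm x : complex.Im (f x) = \1_B x * complex.Im (e i x).
      by rewrite /f Im_mul Re_indic Im_indic mul0r addr0.
    have mR : measurable_fun [set: T] (fun x => complex.Re (f x)).
      by under eq_fun do rewrite fRe; apply: measurable_funM.
    have mI : measurable_fun [set: T] (fun x => complex.Im (f x)).
      by under eq_fun do rewrite fIm; apply: measurable_funM.
    split; first by split.
    apply: le_lt_trans eoo; apply: ge0_le_integral => //.
    - by move=> x _; rewrite lee_fin addr_ge0// sqr_ge0.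
    - by apply/measurable_EFinP; apply: measurable_funD; apply: measurable_funX.
    - by apply/measurable_EFinP; apply: measurable_funD; apply: measurable_funX.
    - move=> x _; rewrite lee_fin fRe fIm indicE; case: (x \in B); rewrite ?mul1r//.
      by rewrite !mul0r expr0n addr0 addr_ge0// sqr_ge0.
  have -> : L2dot mu (compress B A (e i)) (e i) = L2dot mu (A f) f.
    rewrite /L2dot /cintegral; congr Complex; apply: eq_Rintegral => x _.
      rewrite !Re_conj_mul /compress -/f Re_mul Im_mul Re_indic Im_indic.
      rewrite /f Re_mul Im_mul Re_indic Im_indic -/f; ring.
    rewrite !Im_conj_mul /compress -/f Re_mul Im_mul Re_indic Im_indic.
    rewrite /f Re_mul Im_mul Re_indic Im_indic -/f; ring.
  have := L2dotC (A f) f; rewrite -(Asym _ _ fL2 fL2).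
  by case: (L2dot mu (A f) f) => a b /= [] bb; lra.
by move=> /cvg_lim <-//; exact: lim_cst.
Qed.

Lemma Im_diagonal_eq0 : {ae mu, forall x, complex.Im (K x x) = 0}.
Proof.
have H n : {ae mu, forall x, E n x -> complex.Im (K x x) = 0}.
  have [[_ iIm] _] := diagK (mE n) (bE n).
  have : ae_eq mu (E n) (fun x => (complex.Im (K x x))%:E) (cst 0%E).
    apply: integral_ae_eq => // B BE mB; rewrite integral0.
    have iB : mu.-integrable B (fun x => (complex.Im (K x x))%:E).
      exact: integrableS iIm.
    rewrite -[LHS]fineK ?integrable_fin_num//.
    by rewrite [fine _]trace_diagonal_real//; exact: bnd_sub BE (bE n).
  by apply: filterS => x h /h [].
apply: filterS (ae_foralln H) => x xH.
have [i _ Eix] : (\bigcup_k E k) x by rewrite UE.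
exact: xH Eix.
Qed.

(** Almost everywhere the second correlation function is [K x x * K y y] minus
the squared modulus of [K x y]. *)
Lemma integral_det_kernel_le (B C : set T) : measurable B -> measurable C ->
  bnd B -> bnd C ->
  (\int[mu]_(x in B) \int[mu]_(y in C)
     (complex.Re (K x x * K y y - K x y * K y x))%:E <=
   (\int[mu]_(x in B) (complex.Re (K x x))%:E) *
   (\int[mu]_(y in C) (complex.Re (K y y))%:E))%E.
Proof.
move=> mB mC bB bC.
pose k x := complex.Re (K x x).
pose rho (p : T * T) := complex.Re (K p.1 p.1 * K p.2 p.2 - K p.1 p.2 * K p.2 p.1).
have [[iB _] _] := diagK mB bB; have [[iC _] _] := diagK mC bC.
have mdiag : measurable_fun [set: T] (fun x : T => (x, x)).
  exact: measurable_fun_pair.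
have mk : measurable_fun [set: T] k by exact: measurableT_comp mReK mdiag.
have mk' : measurable_fun [set: T] (fun x => complex.Im (K x x)).
  exact: measurableT_comp mImK mdiag.
have mrho : measurable_fun [set: T * T] rho.
  rewrite (_ : rho = fun p => k p.1 * k p.2 -
     complex.Im (K p.1 p.1) * complex.Im (K p.2 p.2) -
     (complex.Re (K p.1 p.2) * complex.Re (K p.2 p.1) -
      complex.Im (K p.1 p.2) * complex.Im (K p.2 p.1))); last first.
    by apply/funext => p; rewrite /rho -!Re_mul; case: (_ * _) => ? ?; case: (_ * _).
  have msw : measurable_fun [set: T * T] (fun p : T * T => (p.2, p.1)).
    exact: measurable_fun_pair.
  have mr2 : measurable_fun [set: T * T] (fun p : T * T => complex.Re (K p.2 p.1)).
    exact: measurableT_comp mReK msw.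
  have mi2 : measurable_fun [set: T * T] (fun p : T * T => complex.Im (K p.2 p.1)).
    exact: measurableT_comp mImK msw.
  have mfst g : measurable_fun [set: T] g ->
      measurable_fun [set: T * T] (fun p : T * T => g p.1 : R).
    by move=> mg; exact: measurableT_comp mg measurable_fst.
  have msnd g : measurable_fun [set: T] g ->
      measurable_fun [set: T * T] (fun p : T * T => g p.2 : R).
    by move=> mg; exact: measurableT_comp mg measurable_snd.
  apply: measurable_funB; apply: measurable_funB; apply: measurable_funM => //.
  - exact: mfst mk.
  - exact: msnd mk.
  - exact: mfst mk'.
  - exact: msnd mk'.
set c := (\int[mu]_(y in C) (complex.Re (K y y))%:E)%E.
have cfin : c \is a fin_num by exact: integrable_fin_num.
rewrite -(fineK cfin) -integralZr//.
apply: ae_le_integral => //.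
- apply: measurable_funTS; exact: (@measurable_section_integral _ _ _ mu C rho).
- apply: measurable_funTS; apply: emeasurable_funM => //.
  exact/measurable_EFinP.
apply: filterS2 kernel_hermitian Im_diagonal_eq0 => x xH x0 Bx.
rewrite (fineK cfin) /c -[complex.Re (K x x)]/(k x) -integralZl//.
apply: ae_le_integral => //.
- apply: measurable_funTS; apply/measurable_EFinP.
  exact: measurableT_comp mrho (pair1_measurable x).
- apply: measurable_funTS; apply: emeasurable_funM => //.
  exact/measurable_EFinP.
apply: filterS xH => y -> _.
rewrite -EFinM lee_fin /k; move: x0.
case: (K x x) => a b /= ->; case: (K y y) => a' b'; case: (K x y) => a2 b2 /=.
nra.
Qed.

End kernel.

(** * Negative correlations of determinantal processes *)
Section dpp_negative_association.
Context d (T : measurableType d) (R : realType) (bnd : set (set T)).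
Variable mu : {measure set T -> \bar R}.

Lemma det_kernel1 (K : T -> T -> R[i]) x (s : 0.-tuple T) :
  det_kernel K (cons_tuple x s) = complex.Re (K x x).
Proof. by rewrite /det_kernel det_mx11 mxE. Qed.

Lemma det_kernel2 (K : T -> T -> R[i]) x y (s : 0.-tuple T) :
  det_kernel K (cons_tuple x (cons_tuple y s)) =
  complex.Re (K x x * K y y - K x y * K y x).
Proof.
rewrite /det_kernel (expand_det_row _ ord0) !big_ord_recl big_ord0.
rewrite /cofactor !det_mx11 !mxE /= !(tnth_nth x) /= addr0 expr0 mul1r expr1.
by rewrite mulN1r mulrN.
Qed.

Lemma is_dpp_negative_association (P : probability (config R bnd) R)
    (K : T -> T -> R[i]) (B C : set T) : is_dpp mu P K ->
  measurable B -> measurable C -> bnd B -> bnd C -> B `&` C = set0 ->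
  (\int[mu]_(x in B) \int[mu]_(y in C)
     (complex.Re (K x x * K y y - K x y * K y x))%:E <=
   (\int[mu]_(x in B) (complex.Re (K x x))%:E) *
   (\int[mu]_(y in C) (complex.Re (K y y))%:E))%E ->
  (\int[P]_xi (xi B * xi C) <= (\int[P]_xi xi B) * (\int[P]_xi xi C))%E.
Proof.
move=> [_ dppP] mB mC bB bC BC det_le.
have intensity S : measurable S -> bnd S ->
    (\int[P]_xi xi S = \int[mu]_(x in S) (complex.Re (K x x))%:E)%E.
  move=> mS bS; have [_ /(_ [tuple S])] := dppP 1%N.
  have -> : (\int[P]_xi \prod_(i < 1) xi (tnth [tuple S] i) = \int[P]_xi xi S)%E.
    by apply: eq_integral => xi _; rewrite big_ord_recl big_ord0 mule1.
  move=> ->.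
  - by apply: eq_integral => x _; rewrite det_kernel1.
  - by move=> i; rewrite ord1.
  - by move=> i; rewrite ord1.
  - by apply/trivIsetP => i j _ _; rewrite !ord1 eqxx.
have [_ /(_ [tuple B; C])] := dppP 2%N.
have -> : (\int[P]_xi \prod_(i < 2) xi (tnth [tuple B; C] i) = \int[P]_xi (xi B * xi C))%E.
  by apply: eq_integral => xi _; rewrite !big_ord_recl big_ord0 mule1.
move=> ->.
- rewrite (intensity B mB bB) (intensity C mC bC); apply: le_trans det_le.
  rewrite le_eqVlt; apply/orP; left.
  apply/eqP; apply: eq_integral => x _; apply: eq_integral => y _.
  by rewrite det_kernel2.
- by case=> -[|[|//]].
- by case=> -[|[|//]].
- by apply/trivIsetP; case=> -[|[|//]] ?; case=> -[|[|//]] ? //= _ _ _; rewrite ?(setIC C).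
Qed.
End dpp_negative_association.

(** * Balls of a metric space *)
Section metric.
Context (R : realType) (L : completeMetricType R).

Lemma metric_bounded_sub (A B : set L) : A `<=` B ->
  metric_bounded B -> metric_bounded A.
Proof. by move=> AB [x [r Bxr]]; exists x, r => y /AB/Bxr. Qed.

Lemma metric_boundedU (A B : set L) : metric_bounded A -> metric_bounded B ->
  metric_bounded (A `|` B).
Proof.
move=> [x [r Ar]] [y [s Bs]]; exists x, (Num.max r (mdist x y + s)) => z [/Ar|/Bs] h.
  by rewrite le_max h.
rewrite le_max; apply/orP; right; apply: le_trans (metric_triangle _ y _) _.
by rewrite lerD2l.
Qed.

Definition metric_ball (n : nat) : set (borel L) := ball (point : L) n%:R.

Lemma measurable_metric_ball n : measurable (metric_ball n).
Proof.
apply: sub_sigma_algebra; rewrite openE => y /=; rewrite /metric_ball ballEmdist /= => xy.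
rewrite /interior -nbhs_ballE.
exists (n%:R - mdist (point : L) (y : L)) => /=; first by rewrite subr_gt0.
move=> z /=; rewrite ballEmdist /= ltrBrDl.
by apply: le_lt_trans; exact: metric_triangle.
Qed.

Lemma metric_ball_bounded n : metric_bounded (metric_ball n : set L).
Proof.
by exists point, n%:R => y; rewrite /metric_ball ballEmdist => /ltW.
Qed.

Lemma nondecreasing_metric_ball : nondecreasing_seq metric_ball.
Proof.
move=> m n mn; apply/subsetPset => x; rewrite /metric_ball !ballEmdist /=.
by move=> /lt_le_trans; apply; rewrite ler_nat.
Qed.

Lemma bigcup_metric_ball : \bigcup_n metric_ball n = [set: borel L].
Proof.
apply/seteqP; split => // x _; exists (Num.truncn (mdist (point : L) (x : L))).+1 => //.
by rewrite /metric_ball ballEmdist; exact: truncnS_gt.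
Qed.

End metric.

Section sigma_finite.
Context d (T : measurableType d) (R : realType) (mu : {measure set T -> \bar R}).
Hypothesis mu_sigma_finite : sigma_finite [set: T] mu.

Let nu : set T -> \bar R := mu.

HB.instance Definition _ := Measure.copy nu mu.
HB.instance Definition _ := @Measure_isSigmaFinite.Build _ _ _ nu mu_sigma_finite.

(** Fubini's theorem is stated for bundled sigma-finite measures, so a measure
with this property is exchanged for such a bundle. *)
Lemma sigma_finite_measureE :
  exists mu' : {sigma_finite_measure set T -> \bar R}, mu = mu'.
Proof. by exists nu; exact: eq_measure. Qed.

End sigma_finite.

(** * Marking rigidity *)

Theorem theorem1p7 (R : realType) (L : completeMetricType R)
  (sepL : separable L)
  (mu : {measure set (borel L) -> \bar R})
  (mu_lfin : forall B : set (borel L), measurable B -> metric_bounded B ->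
    (mu B < +oo)%E)
  (A : (borel L -> R[i]) -> (borel L -> R[i]))
  (K : borel L -> borel L -> R[i])
  (projA : orthogonal_projection mu A)
  (ltcA : locally_trace_class mu (@metric_bounded R L) A)
  (kerA : has_kernel mu A K)
  (diagK : trace_diagonal mu (@metric_bounded R L) A K)
  (P : probability (config R (@metric_bounded R L : set (set (borel L)))) R)
  (dppP : is_dpp mu P K)
  (varP : forall (eps : R) (B : set (borel L)), 0 < eps ->
    measurable B -> metric_bounded B ->
    exists f : borel L -> R,
      [/\ measurable_fun [set: borel L] f,
          exists M : R, forall x, 0 <= f x <= M,
          metric_bounded [set x | f x != 0],
          forall x, B x -> f x = 1 &
          ('V_P[fun xi => (\int[xi]_x f x)%R] < eps%:E)%E]) :
  marking_rigid P.
Proof.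
have [mu' Emu] : exists mu' : {sigma_finite_measure set (borel L) -> \bar R}, mu = mu'.
  apply: sigma_finite_measureE; exists (@metric_ball R L); first by rewrite bigcup_metric_ball.
  move=> n; split; first exact: measurable_metric_ball.
  by apply: mu_lfin; [exact: measurable_metric_ball|exact: metric_ball_bounded].
subst mu.
pose bnd : set (set (borel L)) := @metric_bounded R L.
have bnd_sub : forall B C : set (borel L), B `<=` C -> bnd C -> bnd B.
  by move=> B C; exact: metric_bounded_sub.
have bndU : forall B C : set (borel L), bnd B -> bnd C -> bnd (B `|` C).
  by move=> B C; exact: metric_boundedU.
have NA (B C : set (borel L)) : measurable B -> measurable C -> bnd B -> bnd C ->
    B `&` C = set0 ->
    (\int[P]_xi (xi B * xi C) <= (\int[P]_xi xi B) * (\int[P]_xi xi C))%E.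
  move=> mB mC bB bC BC; apply: (is_dpp_negative_association dppP) => //.
  exact: (integral_det_kernel_le (mu := mu') (@measurable_metric_ball R L)
    (@metric_ball_bounded R L) (@nondecreasing_metric_ball R L)
    (@bigcup_metric_ball R L) bnd_sub mu_lfin projA ltcA kerA diagK).
have small (eps : R) (B : set (borel L)) : 0 < eps -> measurable B -> bnd B ->
    exists f : borel L -> R, [/\ test_function bnd f, forall x, B x -> f x = 1 &
    ('V_P[@linear_statistic _ _ R bnd f] < eps%:E)%E].
  move=> e0 mB bB; have [f [mf fM bf fB Vf]] := varP eps B e0 mB bB.
  by exists f; split.
have /choice[f fP] : forall k, exists f : borel L -> R,
    [/\ measurable_fun [set: borel L] f, forall x, 0 <= f x <= 1,
      bnd [set x | f x != 0], forall x, metric_ball k x -> f x = 1 &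
      ('V_P[@linear_statistic _ _ R bnd f] < (1 / (2 ^ k.+1)%:R)%:E)%E].
  move=> k; apply: (small_variance_le1 bnd_sub bndU NA small).
  - by rewrite divr_gt0.
  - exact: measurable_metric_ball.
  - exact: metric_ball_bounded.
apply: (marking_rigid_of_vanishing_variance (@measurable_metric_ball R L)
  (@nondecreasing_metric_ball R L) (@bigcup_metric_ball R L) (f := f)) => k;
  by have [] := fP k.
Qed.
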